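(* Let $\Delta=0$, $t>0$, and let $x\le1$ be an integer. Then $$\lim_{N\to\infty}\mathbb{P}_{\{1,\dots,N\}}(X_1(t)\ge x)\big|_{\Delta=0}=\det(I-L)_{\ell^2(\{0,1,2,\dots\})},$$ where $L$ is the operator with kernel (the discrete Bessel kernel), for $j,k\in\{0,1,2,\dots\}$, $$L(j,k)=\int_{\mathcal{C}_r}\int_{\mathcal{C}_r}\frac{\xi^{-x+j+1}\zeta^{-x+k+1}e^{-t(\theta(\xi)+\theta(\zeta))}}{1-\xi\zeta}\,d\zeta\,d\xi,\qquad \theta(\xi)=\xi-\frac1\xi,$$ with $\mathcal{C}_r$ the circle centered at zero of radius $r<1$; for $j\ne k$ this kernel equals $$t\,\frac{J_{j-x+1}(2t)J_{k-x+2}(2t)-J_{j-x+2}(2t)J_{k-x+1}(2t)}{j-k},$$ with $J_\nu$ the Bessel function of order $\nu$.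
   Context: Let $\mathcal{X}_N$ be the set of all $X=\{x_1<\dots<x_N\}\subset\mathbb{Z}$ and $\mathcal{H}_N=\ell^2(\mathcal{X}_N)$ with orthonormal basis $e_X(Y)=\delta_{X,Y}$. The XXZ spin-$\frac12$ Hamiltonian with anisotropy $\Delta\in\mathbb{R}$ is $H_{XXZ}=\sum_{j\in\mathbb{Z}}h_{j,j+1}$, where $h_{j,j+1}e_X=0$ if both or neither of $j,j+1$ belong to $X$, and $h_{j,j+1}e_X=-\Delta e_X+e_{X'}$ if exactly one of them belongs to $X$, with $X'$ obtained from $X$ by exchanging the occupation of $j$ and $j+1$. It is self-adjoint on $\mathcal{H}_N$. For $Y\in\mathcal{X}_N$ write $e^{-itH_{XXZ}}e_Y=\sum_X\psi_N(X;t)e_X$ and $\mathbb{P}_Y(X_1(t)\ge x)=\sum_{X\in\mathcal{X}_N,\,x_1\ge x}|\psi_N(X;t)|^2$. The determinant is a Fredholm determinant. Circles are positively oriented and every differential $d\xi,d\zeta$ incorporates the factor $(2\pi i)^{-1}$. *)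

(* Defs.v *)
From HB Require Import structures.
From mathcomp Require Import all_boot all_order all_algebra finmap.
From mathcomp Require Import complex.
From mathcomp Require Import all_classical all_reals all_analysis.

Set Implicit Arguments.
Unset Strict Implicit.
Unset Printing Implicit Defensive.

Import Order.TTheory GRing.Theory Num.Theory.
Import numFieldNormedType.Exports.

Local Open Scope classical_set_scope.
Local Open Scope ring_scope.
Local Open Scope complex_scope.

Definition config (N : nat) := {X : {fset int} | #|` X| == N}.

(* x_1, for X = {x_1 < ... < x_N}; the default value 0 only matters for N = 0. *)
Definition leftmost N (X : config N) : int :=
  head 0 (sort <=%R (enum_fset (val X))).

Definition transpose (j i : int) : int :=
  if i == j then j + 1 else if i == j + 1 then j else i.

Lemma transposeK j : involutive (transpose j).
Proof.
move=> i; rewrite /transpose.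
have j1 : (j + 1 == j) = false by rewrite -subr_eq0 addrAC subrr.
case: (eqVneq i j) => [->|ij]; first by rewrite j1 eqxx.
case: (eqVneq i (j + 1)) => [->|ij1]; first by rewrite eqxx.
by rewrite (negbTE ij) (negbTE ij1).
Qed.

Lemma exchange_subproof N (j : int) (X : config N) :
  #|` [fset transpose j i | i in val X]%fset| == N.
Proof. by rewrite card_imfset ?(valP X)//; exact/inv_inj/transposeK. Qed.

(* X with the occupations of j and j + 1 exchanged *)
Definition exchange N (j : int) (X : config N) : config N :=
  exist (fun Z : {fset int} => #|` Z| == N) _ (exchange_subproof j X).

Lemma in_exchange N (j i : int) (X : config N) :
  (i \in val (exchange j X)) = (transpose j i \in val X).
Proof.
apply/imfsetP/idP => [[k /= kX ->]|iX]; first by rewrite transposeK.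
by exists (transpose j i) => //; rewrite transposeK.
Qed.

Lemma exchangeK N j : involutive (@exchange N j).
Proof.
by move=> X; apply/val_inj/fsetP => i; rewrite !in_exchange transposeK.
Qed.

Lemma step_subproof N :
  #|` [fset k in [seq i%:Z | i <- iota 1 N]]%fset| == N.
Proof.
rewrite card_fseq undup_id ?size_map ?size_iota//.
by rewrite map_inj_uniq ?iota_uniq// => i j [].
Qed.

(* {1, ..., N} *)
Definition step N : config N :=
  exist (fun Z : {fset int} => #|` Z| == N) _ (step_subproof N).

Section hamiltonian.
Variable R : realType.
Variable N : nat.

(* Coordinates in the orthonormal basis (e_X): f stands for \sum_X f(X) e_X. *)
Definition wave := config N -> R[i].

Definition basis_vec (X : config N) : wave := fun Y => (Y == X)%:R.

(* The linear extension of the prescription on basis vectors, cf. bond_basis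
   below; the coefficient of e_X in h_{j,j+1} f collects contributions from
   f(X) and from f(exchange j X) because exchange j is an involution. *)
Definition bond (Delta : R) (j : int) (f : wave) : wave := fun X =>
  if (j \in val X) (+) (j + 1 \in val X)
  then - Delta%:C * f X + f (exchange j X) else 0.

Lemma bond_basis (Delta : R) (j : int) (X : config N) :
  bond Delta j (basis_vec X) =
  if (j \in val X) (+) (j + 1 \in val X)
  then (fun Y => - Delta%:C * basis_vec X Y + basis_vec (exchange j X) Y)
  else (fun=> 0).
Proof.
have swap (Y : config N) : (exchange j Y == X) = (Y == exchange j X).
  by rewrite -{1}[X](exchangeK j) (inj_eq (inv_inj (@exchangeK N j))).
have occ (Y : config N) : (j \in val (exchange j Y)) (+) (j + 1 \in val (exchange j Y)) =
             (j \in val Y) (+) (j + 1 \in val Y).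
  have j1 : (j + 1 == j) = false by rewrite -subr_eq0 addrAC subrr.
  by rewrite !in_exchange /transpose j1 !eqxx addbC.
apply/funext => Y; rewrite /bond /basis_vec swap.
have [->|YX] := eqVneq Y X; first by case: ifP => //=; rewrite eqxx.
have [YE|YX'] := eqVneq Y (exchange j X).
  rewrite {1 2}YE occ; case: ifP => // _.
  by rewrite (negbTE YX) YE eqxx.
by rewrite mulr0 addr0; case: ifP; case: ifP => //;
  rewrite (negbTE YX) (negbTE YX') mulr0 addr0.
Qed.

(* For each X only finitely many j contribute to the coefficient of e_X. *)
Definition Hxxz (Delta : R) (f : wave) : wave := fun X =>
  \sum_(j \in [set: int]) bond Delta j f X.

Definition sqnorm (f : wave) : \bar R :=
  (\esum_(X in [set: config N]) (ComplexField.Normc.normc (f X) ^+ 2)%:E)%E.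

Definition cvg_l2 (u : nat -> wave) (f : wave) : Prop :=
  sqnorm (fun X => u n X - f X) @[n --> \oo] --> 0%E.

Definition exp_partial (A : wave -> wave) (f : wave) (n : nat) : wave :=
  fun X => \sum_(0 <= k < n) (k`!%:R)^-1 * iter k A f X.

(* exp(A) f = \sum_k A^k f / k!, the series converging in l^2. For A = -itH
   it does, as H is bounded on l^2: a set of N integers has at most 2N bonds
   {j, j+1} with exactly one occupied end. *)
Definition expop (A : wave -> wave) (f : wave) : wave :=
  xget (fun=> 0) [set g | cvg_l2 (exp_partial A f) g].

Definition psi (Delta t : R) (Y : config N) : wave :=
  expop (fun f X => - 'i * t%:C * Hxxz Delta f X) (basis_vec Y).

(* P_Y(X_1(t) >= x) *)
Definition prob_leftmost_ge (Delta t : R) (Y : config N) (x : int) : \bar R :=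
  (\esum_(X in [set X : config N | (x <= leftmost X)%R])
     (ComplexField.Normc.normc (psi Delta t Y X) ^+ 2)%:E)%E.

End hamiltonian.

Section kernel.
Variable R : realType.

Definition cexp (z : R[i]) : R[i] :=
  (expR (complex.Re z))%:C * (cos (complex.Im z) +i* sin (complex.Im z)).

(* (2 pi i)^-1 times the integral of F over the positively oriented circle of
   radius r centred at 0: with z = r exp(i phi), dz / (2 pi i) is
   z dphi / (2 pi). *)
Definition circle_int (r : R) (F : R[i] -> R[i]) : R[i] :=
  let G (phi : R) := let z := r%:C * cexp ('i * phi%:C) in F z * z in
  ((2 * pi)^-1)%:C *
  ((\int[lebesgue_measure]_(phi in `[0, 2 * pi]) complex.Re (G phi))%R +i*
   (\int[lebesgue_measure]_(phi in `[0, 2 * pi]) complex.Im (G phi))%R).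

Definition theta (xi : R[i]) : R[i] := xi - xi^-1.

Definition Lkernel (r t : R) (x : int) (j k : nat) : R[i] :=
  circle_int r (fun xi => circle_int r (fun zeta =>
    xi ^ (- x + j%:Z + 1) * zeta ^ (- x + k%:Z + 1)
    * cexp (- t%:C * (theta xi + theta zeta)) / (1 - xi * zeta))).

(* Fredholm determinant det(I - K) on l^2({0, 1, 2, ...}), by the Fredholm
   series \sum_n (-1)^n / n! \sum_(i_1, ..., i_n) det (K i_a i_b)_(a, b). *)
Definition fredholm_minors (K : nat -> nat -> R[i]) (n : nat) : R[i]^o :=
  limn (fun M => (\sum_(s : {ffun 'I_n -> 'I_M})
    \det (\matrix_(a < n, b < n) K (s a) (s b))) : R[i]^o).

Definition fredholm_det (K : nat -> nat -> R[i]) : R[i]^o :=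
  limn (series (fun n =>
    ((-1) ^+ n / n`!%:R * fredholm_minors K n) : R[i]^o)).

(* Bessel function of integer order nu:
   \sum_m (-1)^m / (m! Gamma(m + nu + 1)) (z / 2)^(2m + nu),
   where 1 / Gamma vanishes at the nonpositive integers. *)
Definition besselJ (nu : int) (z : R) : R :=
  limn (series (fun m : nat =>
    if (0 <= m%:Z + nu)%R
    then (-1) ^+ m / (m`!%:R * (absz (m%:Z + nu))`!%:R)
         * (z / 2) ^ (m%:Z *+ 2 + nu)
    else 0)).

End kernel.

(* Main.v *)
Require Import Defs.
From HB Require Import structures.
From mathcomp Require Import all_boot all_order all_algebra fingroup perm finmap.
From mathcomp Require Import complex ring lra zify.
From mathcomp Require Import all_classical all_reals all_analysis measurable_realfun.

Set Implicit Arguments.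
Unset Strict Implicit.
Unset Printing Implicit Defensive.

Import Order.TTheory GRing.Theory Num.Theory.
Import numFieldNormedType.Exports.
Local Open Scope ring_scope.

(** At zero anisotropy the spins are free fermions. A single particle that
    hops to the left or to the right moves by [n] during the time [t] with the
    amplitude J_n(2t), up to a power of - i; this is the coefficient of w^n in
    exp (t (w - 1/w)). Particles hop to empty neighbouring sites and keep their
    order, so the wave on configurations is the restriction of an antisymmetric
    wave of [N] independent particles. Its value at X = {x_1 < ... < x_N} is
    therefore the determinant of the J_(x_a - b)(2t), up to a factor of modulus
    one ([psi_free]). The proof compares Taylor coefficients in the time: the
    iterates of the Hamiltonian and the coefficients of the determinant obey
    the same recursion ([amp_det]), and an l^1 bound sums the series in l^2
    ([free_wave_cvg_l2]).

    The probability is the sum of the squared determinants over the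
    configurations to the right of [x]. By the Cauchy-Binet formula it is the
    determinant of the sums of J_(n-a) J_(n-b) over n >= x ([prob_gap_gram]).
    The translates of J being orthonormal ([bes_orthonormal]), these sums are,
    up to signs, the entries of 1 - L_N, where L_N is the corner of size [N] of
    the discrete Bessel kernel ([prob_det_kernel]). The determinant of 1 - L_N is a sum of
    principal minors ([det_1D_expand]). The kernel decays exponentially in both
    indices, which bounds the minors uniformly in [N], and the limit can be
    taken term by term in the Fredholm series ([det_fredholm_cvg]).

    For the contour integral, expanding 1 / (1 - xi zeta) in a geometric series
    and both exponentials in Laurent series gives the sum of products of Bessel
    values ([Lkernel_bes]). The recurrence n J_n = t (J_(n-1) + J_(n+1)) makes
    this sum telescope off the diagonal ([bes_product_sum]), which is the second
    claim. *)

(** * Determinants: Cauchy-Binet and the expansion of det (1 + A) *)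

(** Both sides are the determinant of the block matrix with rows (1, - E) and
    (F, 1), factored into triangular blocks in two ways. *)
Lemma det_sylvester (R : comNzRingType) (m n : nat) (E : 'M[R]_(m, n)) (F : 'M[R]_(n, m)) :
  \det (1%:M + E *m F) = \det (1%:M + F *m E).
Proof.
have e1 : block_mx 1%:M (- E) F 1%:M =
    block_mx 1%:M 0 F 1%:M *m block_mx 1%:M (- E) 0 (1%:M + F *m E).
  rewrite mulmx_block !mul1mx !mul0mx !mulmx1 !addr0; congr block_mx.
  by rewrite mulmxN addrC addrK.
have e2 : block_mx 1%:M (- E) F 1%:M =
    block_mx (1%:M + E *m F) (- E) 0 1%:M *m block_mx 1%:M 0 F 1%:M.
  rewrite mulmx_block !mul0mx ?mul1mx !mulmx1 ?mulmx0 !add0r; congr block_mx.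
  by rewrite mulNmx addrK.
have := congr1 (@determinant R (m + n)) e2; rewrite e1 !det_mulmx.
by rewrite !det_lblock !det_ublock !det1 !mul1r !mulr1.
Qed.

(** Each set of n elements is the image of exactly n! injective maps. *)
Lemma sum_injective_ffun (R : nmodType) (T : finType) (n : nat) (F : {set T} -> R) :
  \sum_(s : {ffun 'I_n -> T} | injectiveb s) F [set s a | a : 'I_n] =
  (\sum_(S : {set T} | #|S| == n) F S) *+ n`!.
Proof.
rewrite (partition_big (fun s : {ffun 'I_n -> T} => [set s a | a : 'I_n])
  (fun S : {set T} => #|S| == n)) /=; last first.
  by move=> s /injectiveP si; rewrite card_imset // card_ord.
rewrite -sumrMnl; apply: eq_bigr => S /eqP cS.
rewrite (eq_bigr (fun=> F S)); last by move=> s /andP[_ /eqP ->].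
rewrite sumr_const; congr (_ *+ _).
have -> : n`! = #|S| ^_ #|'I_n| by rewrite cS card_ord ffactnn.
rewrite -card_inj_ffuns_on; apply: eq_card => s; rewrite !inE.
apply/andP/andP => [[si /eqP <-]|[/ffun_onP sS si]].
  by split=> //; apply/ffun_onP => a; apply: imset_f.
split=> //; rewrite eqEcard; apply/andP; split.
  by apply/fintype.subsetP => _ /imsetP[a _ ->]; apply: sS.
by rewrite card_imset ?card_ord ?cS//; apply/injectiveP.
Qed.

(** The rows outside S are those of the identity, so that the determinant is
    the principal minor of A on S; no renumbering of the elements of S is
    needed. *)
Definition border_minor (R : comNzRingType) (N : nat) (A : 'M[R]_N) (S : {set 'I_N}) : 'M[R]_N :=
  \matrix_(i, j) (if i \in S then A i j else (i == j)%:R).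

(** In each term of the Leibniz formula, expanding the product over the rows
    amounts to choosing the set S of rows in which A is taken rather than 1.
    *)
Lemma det_1D (R : comNzRingType) (N : nat) (A : 'M[R]_N) :
  \det (1%:M + A) = \sum_(S : {set 'I_N}) \det (border_minor A S).
Proof.
rewrite exchange_big /=; apply: eq_bigr => s _; rewrite -big_distrr /=; congr (_ * _).
rewrite (eq_bigr (fun i => A i (s i) + (i == s i)%:R)); last first.
  by move=> i _; rewrite !mxE addrC.
rewrite bigA_distr /=; apply: eq_bigr => S _.
by apply: eq_bigr => i _; rewrite mxE; case: ifP.
Qed.

(** Let E be the matrix that selects the indices s a. The bordered matrix is 1
    + E (E^T (A - 1)), and E^T E = 1 as s is injective, so det (1 + E F) = det
    (1 + F E) reduces it to E^T A E. *)
Lemma det_border_minor (R : comNzRingType) (N n : nat) (A : 'M[R]_N) (s : 'I_n -> 'I_N) :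
  injective s ->
  \det (border_minor A [set s a | a : 'I_n]) = \det (\matrix_(a, b) A (s a) (s b)).
Proof.
move=> si; pose E : 'M[R]_(N, n) := \matrix_(i, a) (i == s a)%:R.
have EtM m (B : 'M[R]_(N, m)) a j : (E^T *m B) a j = B (s a) j.
  rewrite !mxE (bigD1 (s a)) //= !mxE eqxx mul1r big1 ?addr0 // => i ia.
  by rewrite !mxE (negbTE ia) mul0r.
have -> : border_minor A [set s a | a : 'I_n] = 1%:M + E *m (E^T *m (A - 1%:M)).
  apply/matrixP => i j; rewrite mxE [RHS]mxE [X in _ = _ + X]mxE [1%:M i j]mxE.
  under eq_bigr do rewrite EtM !mxE.
  case: imsetP => [[a _ ->]|iS].
    rewrite (bigD1 a) //= eqxx mul1r big1 ?addr0 => [|b ba]; first by rewrite [RHS]addrC subrK.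
    by rewrite (inj_eq si) eq_sym (negbTE ba) mul0r.
  rewrite big1 ?addr0 // => a _; rewrite (_ : i == s a = false) ?mul0r//.
  by apply/eqP => ia; apply: iS; exists a.
rewrite det_sylvester; congr determinant; apply/matrixP => a b.
rewrite -mulmxA mxE EtM !mxE (bigD1 (s b)) //= big1 => [|i ib]; last first.
  by rewrite !mxE (negbTE ib) mulr0.
by rewrite !mxE eqxx mulr1 addr0 (inj_eq si) addrC subrK.
Qed.

Lemma det_mxsub_noninj (R : comNzRingType) (n : nat) (T : eqType) (T' : Type)
    (B : T -> T' -> R) (s : 'I_n -> T) (s' : 'I_n -> T') :
  ~~ injectiveb s -> \det (\matrix_(a < n, b < n) B (s a) (s' b)) = 0.
Proof.
case/injectivePn => a [b ab sab].
by apply: (determinant_alternate ab) => j; rewrite !mxE sab.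
Qed.

(** The finite form of the Fredholm series, with c n the inverse of n!. The
    terms with n > N vanish, which leaves the cut-off K free and lets the sum
    be compared with an infinite series. *)
Lemma det_1D_expand (R : comNzRingType) (N K : nat) (A : 'M[R]_N) (c : nat -> R) :
  (forall n, c n * n`!%:R = 1) -> (N < K)%N ->
  \det (1%:M + A) = \sum_(n < K) c n *
    \sum_(s : {ffun 'I_n -> 'I_N}) \det (\matrix_(a, b) A (s a) (s b)).
Proof.
move=> cn NK; rewrite det_1D.
rewrite (partition_big (fun S : {set 'I_N} => inord #|S| : 'I_K.-1.+1) xpredT) //=.
case: K NK => [//|K] NK /=; apply: eq_bigr => n _.
rewrite [X in _ = _ * X](bigID (fun s : {ffun 'I_n -> 'I_N} => injectiveb s)) /=.
rewrite [X in _ + X]big1 ?addr0 => [|s]; last exact: det_mxsub_noninj.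
rewrite (eq_bigr (fun s : {ffun 'I_n -> 'I_N} =>
  \det (border_minor A [set s a | a : 'I_n]))); last first.
  by move=> s /injectiveP si; rewrite det_border_minor.
rewrite (sum_injective_ffun n (fun S => \det (border_minor A S))) -[X in _ * X]mulr_natl mulrA cn mul1r.
apply: eq_bigl => S; apply/eqP/eqP => [<-|->]; last exact: inord_val.
by rewrite inordK // ltnS (leq_trans (max_card _)) // card_ord.
Qed.

Lemma det_mulmx_expand (R : comNzRingType) (n M : nat) (A : 'M[R]_(n, M)) (B : 'M[R]_(M, n)) :
  \det (A *m B) = \sum_(s : {ffun 'I_n -> 'I_M})
    (\prod_a A a (s a)) * \det (\matrix_(a, b) B (s a) b).
Proof.
under [RHS]eq_bigr do rewrite big_distrr /=.
rewrite exchange_big /=; apply: eq_bigr => t _.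
under eq_bigr => i _ do rewrite mxE.
rewrite (bigA_distr_bigA (fun i j => A i j * B j (t i))) /= big_distrr /=.
apply: eq_bigr => s _; rewrite big_split /= mulrCA; congr (_ * (_ * _)).
by apply: eq_bigr => i _; rewrite mxE.
Qed.

(** The Cauchy-Binet formula, summed over maps instead of sets of n elements;
    each set then appears n! times. *)
Lemma Cauchy_Binet_ffun (R : comNzRingType) (n M : nat) (A : 'M[R]_(n, M)) (B : 'M[R]_(M, n)) :
  \sum_(s : {ffun 'I_n -> 'I_M})
    \det (\matrix_(a, b) A a (s b)) * \det (\matrix_(a, b) B (s a) b) =
  \det (A *m B) *+ n`!.
Proof.
under eq_bigr do rewrite -det_tr big_distrl /=.
have -> : n`! = #|[set: 'S_n]| by rewrite cardsT card_Sn.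
rewrite exchange_big /= -sumr_const.
rewrite [RHS](eq_bigl xpredT); last by move=> ?; rewrite inE.
apply: eq_bigr => t _; rewrite det_mulmx_expand.
rewrite [RHS](reindex_inj (h := fun s : {ffun 'I_n -> 'I_M} => [ffun a => s (t^-1 a)%g])) /=; last first.
  move=> s s' /ffunP ss; apply/ffunP => a; have := ss (t a).
  by rewrite !ffunE !permK.
apply: eq_bigr => s _; rewrite -[LHS]mulrA mulrCA; congr (_ * _).
  rewrite [RHS](reindex_inj (@perm_inj _ t)) /=.
  by apply: eq_bigr => a _; rewrite !mxE ffunE permK.
have -> : \matrix_(a, b) B ([ffun a0 => s ((t^-1)%g a0)] a) b =
   row_perm (t^-1)%g (\matrix_(a, b) B (s a) b).
  by apply/matrixP => a b; rewrite !mxE ffunE.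
by rewrite row_permE det_mulmx det_perm odd_permV.
Qed.

(** The largest of n distinct natural numbers is at least n - 1; remove it and
    induct. *)
Lemma fact_le_prod_uniq (s : seq nat) : uniq s -> ((size s)`! <= \prod_(i <- s) i.+1)%N.
Proof.
have [n] := ubnP (size s); elim: n s => // n IH [|x s] //= sn us.
  by rewrite big_nil.
have [m ms mn] : exists2 m, m \in x :: s & (size s <= m)%N.
  apply/hasP; apply: contraT => /hasPn h.
  have : (size (x :: s) <= size (iota 0 (size s)))%N.
    apply: uniq_leq_size => // y ys; rewrite mem_iota /=.
    by rewrite ltnNge; exact: h.
  by rewrite size_iota /= ltnn.
have p := perm_to_rem ms.
have srem : size (rem m (x :: s)) = size s by rewrite size_rem.
rewrite (perm_big _ p) big_cons factS leq_mul // -[X in X`!]srem.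
by apply: IH; rewrite ?srem ?rem_uniq.
Qed.

Lemma fact_le_prod_inj (n : nat) (s : 'I_n -> nat) :
  injective s -> (n`! <= \prod_a (s a).+1)%N.
Proof.
move=> si; have := @fact_le_prod_uniq [seq s a | a <- enum 'I_n].
rewrite map_inj_uniq // enum_uniq size_map size_enum_ord => /(_ isT).
by rewrite big_map big_enum.
Qed.

(** Two enumerations of the same set differ by a permutation, whose sign
    disappears in the square. *)
Lemma det_enum_sqr (R : comNzRingType) (n : nat) (T : eqType) (B : T -> 'I_n -> R)
    (s s' : 'I_n -> T) : injective s -> injective s' ->
  (forall a, exists b, s a = s' b) ->
  \det (\matrix_(a, b) B (s a) b) ^+ 2 = \det (\matrix_(a, b) B (s' a) b) ^+ 2.
Proof.
move=> si s'i ss.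
have h a : exists b, s a == s' b by have [b ->] := ss a; exists b.
pose p a := xchoose (h a).
have pE a : s a = s' (p a) by apply/eqP; exact: (xchooseP (h a)).
have pi : injective p by move=> a b pab; apply: si; rewrite !pE pab.
have -> : \matrix_(a, b) B (s a) b = row_perm (perm pi) (\matrix_(a, b) B (s' a) b).
  by apply/matrixP => a b; rewrite !mxE pE permE.
by rewrite row_permE det_mulmx det_perm exprMn sqrr_sign mul1r.
Qed.

Lemma det_le (R : numDomainType) (n : nat) (A : 'M[R]_n) (u v : 'I_n -> R) :
  (forall a b, `|A a b| <= u a * v b) ->
  `|\det A| <= n`!%:R * (\prod_a u a * \prod_a v a).
Proof.
move=> h; apply: le_trans (ler_norm_sum _ _ _) _.
have -> : n`! = #|[set: 'S_n]| by rewrite cardsT card_Sn.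
rewrite mulr_natl -sumr_const [leRHS](eq_bigl xpredT); last by move=> ?; rewrite inE.
apply: ler_sum => s _; rewrite normrM normr_sign mul1r normr_prod.
rewrite [\prod_a v a](reindex_inj (@perm_inj _ s)) -big_split /=.
by apply: ler_prod => i _; rewrite normr_ge0 h.
Qed.

(** * Taylor coefficients of the Bessel functions *)

(** The coefficient of s^k w^n in exp (s t (w - 1/w)); the recursion is the
    differential equation in s. Summed over k, it gives J_n(2t). *)
Fixpoint bcoef (F : numFieldType) (t : F) (k : nat) (n : int) : F :=
  if k is k'.+1 then t / k%:R * (bcoef t k' (n - 1) - bcoef t k' (n + 1))
  else (n == 0)%:R.

Section BesselCoefficients.
Variables (F : realFieldType) (t : F).
Implicit Types (k : nat) (n : int).
Local Notation u := (bcoef t).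

Lemma bcoefS k n : k.+1%:R * u k.+1 n = t * (u k (n - 1) - u k (n + 1)).
Proof. by rewrite /= mulrA mulrCA divff ?mulr1 // pnatr_eq0. Qed.

(** Differentiating the generating function in w instead of s; this is n J_n =
    t (J_(n-1) + J_(n+1)), degree by degree. *)
Lemma bcoef_recurrence k n : n%:~R * u k.+1 n = t * (u k (n - 1) + u k (n + 1)).
Proof.
elim: k n => [|k IH] n.
  rewrite /= divr1 mulrCA; congr (_ * _).
  rewrite -[n - 1 == 0]/(n - 1 == 0) subr_eq0 addr_eq0.
  have [->|n1] := eqVneq n 1; first by rewrite mul1r subr0 addr0.
  have [->|n2] := eqVneq n (-1); first by rewrite sub0r add0r mulrNN mulr1.
  by rewrite subrr mulr0 addr0.
apply: (mulfI (_ : k.+2%:R != 0)); first by rewrite pnatr_eq0.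
rewrite mulrCA bcoefS.
have e1 : (n%:~R - 1) * u k.+1 (n - 1) = t * (u k (n - 1 - 1) + u k n).
  by have := IH (n - 1); rewrite intrB subrK.
have e2 : (n%:~R + 1) * u k.+1 (n + 1) = t * (u k n + u k (n + 1 + 1)).
  by have := IH (n + 1); rewrite intrD addrK.
have f1 := bcoefS k (n - 1); have f2 := bcoefS k (n + 1).
rewrite subrK in f1; rewrite addrK in f2.
rewrite -[k.+2]addn1 natrD.
transitivity (t * ((n%:~R - 1) * u k.+1 (n - 1) + u k.+1 (n - 1)
   - ((n%:~R + 1) * u k.+1 (n + 1) - u k.+1 (n + 1)))); first ring.
rewrite e1 e2.
transitivity (t * (t * (u k (n - 1 - 1) - u k n) + t * (u k n - u k (n + 1 + 1))
   + u k.+1 (n - 1) + u k.+1 (n + 1))); first ring.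
by rewrite -f1 -f2; ring.
Qed.

Lemma bcoef_support k n : (k < `|n|)%N -> u k n = 0.
Proof.
elim: k n => [|k IH] n kn /=; first by have -> : (n == 0) = false by lia.
by rewrite !IH ?subrr ?mulr0 //; lia.
Qed.

(** The parameter rho is free: rho < 1 gives decay as n tends to +oo, and rho
    > 1 as n tends to -oo. *)
Lemma bcoef_le (rho : F) k n : 0 <= t -> 0 < rho ->
  `|u k n| <= rho ^ n * (t * (rho + rho^-1)) ^+ k / k`!%:R.
Proof.
move=> t0 r0; elim: k n => [|k IH] n.
  rewrite /= expr0 divr1 mulr1; case: eqP => [->|_]; first by rewrite normr1 expr0z.
  by rewrite normr0 exprz_ge0 // ltW.
rewrite [u _ _]/= normrM ger0_norm ?divr_ge0 //.
apply: le_trans (ler_wpM2l _ (ler_normB _ _)) _; first by rewrite divr_ge0.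
apply: le_trans (ler_wpM2l _ (lerD (IH _) (IH _))) _; first by rewrite divr_ge0.
have r0' : rho != 0 by rewrite gt_eqF.
rewrite -[-1]/(- 1%:Z) !expfzDr // expr1z exprN1 factS natrM exprS invfM.
have k1 : k.+1%:R != 0 :> F by rewrite pnatr_eq0.
have k2 : k`!%:R != 0 :> F by rewrite pnatr_eq0 -lt0n fact_gt0.
rewrite le_eqVlt; apply/orP; left; apply/eqP; move: (_ ^+ k) (rho ^ n) => p q.
by field; rewrite k2 r0' -[1]/(1%:R) -natrD add1n k1.
Qed.

(** The reciprocal of the Gamma function at p + 1. *)
Definition invfact (p : int) : F := if 0 <= p then (`|p|%N)`!%:R^-1 else 0.

Lemma invfact_mul (p : int) : p%:~R * invfact p = invfact (p - 1).
Proof.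
rewrite /invfact; have [p0|p0] := leP 0 p; last first.
  by rewrite mulr0; have -> : (0 <= p - 1) = false by lia.
have [->|pn] := eqVneq p 0; first by rewrite mul0r.
have -> : 0 <= p - 1 by lia.
have [m ->] : exists m : nat, p = m.+1 by exists `|p|.-1%N; lia.
have -> : m.+1%:Z - 1 = m by lia.
by rewrite -pmulrn !absz_nat factS natrM invfM mulrA divff ?mul1r ?pnatr_eq0.
Qed.

(** A walk of k unit steps, q of them to the left, ends at k - 2 q. The two
    instances of invfact make the formula valid for all integers q. *)
Lemma bcoef_closed k (q : int) :
  u k (k%:Z - q *+ 2) = (-1) ^ q * t ^+ k * invfact q * invfact (k%:Z - q).
Proof.
elim: k q => [|k IH] q.
  rewrite /= !sub0r oppr_eq0 mulrn_eq0 /= expr0 mulr1 /invfact.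
  have [->|q0] := eqVneq q 0; first by rewrite expr0z /= fact0 invr1 !mulr1.
  have [q1|q1] := leP 0 q; last by rewrite mulr0 mul0r.
  have -> : (0 <= - q) = false by lia.
  by rewrite mulr0.
apply: (mulfI (_ : k.+1%:R != 0)); first by rewrite pnatr_eq0.
rewrite bcoefS.
have -> : k.+1%:Z - q *+ 2 - 1 = k%:Z - q *+ 2 by lia.
have -> : k.+1%:Z - q *+ 2 + 1 = k%:Z - (q - 1) *+ 2 by lia.
rewrite !IH exprS expfzDr ?oppr_eq0 ?oner_eq0 // exprN1 invrN1.
have -> : k%:Z - (q - 1) = k.+1%:Z - q by lia.
have -> : k%:Z - q = k.+1%:Z - q - 1 by lia.
rewrite -!invfact_mul.
have -> : k.+1%:R = q%:~R + (k.+1%:Z - q)%:~R :> F by rewrite -intrD subrKC.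
by ring.
Qed.

Lemma bcoef_parity k (q : int) : u k (k%:Z - q *+ 2 + 1) = 0.
Proof.
elim: k q => [|k IH] q /=; first by have -> : (0 - q *+ 2 + 1 == 0) = false by lia.
have -> : k.+1%:Z - q *+ 2 + 1 - 1 = k%:Z - q *+ 2 + 1 by lia.
have -> : k.+1%:Z - q *+ 2 + 1 + 1 = k%:Z - (q - 1) *+ 2 + 1 by lia.
by rewrite !IH subrr mulr0.
Qed.

End BesselCoefficients.

Local Open Scope classical_set_scope.
Local Open Scope ring_scope.
Local Open Scope complex_scope.
Import ComplexField.Normc.

(** * Dominated series *)

Section DominatedSeries.
Variables (R : realType) (b : R^nat).
Hypothesis b_cvg : cvgn (series b).

Lemma dominated_series_cvg (c : R^nat) : (forall k, `|c k| <= b k) -> cvgn (series c).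
Proof.
move=> cb; apply: normed_cvg; apply: (series_le_cvg _ _ _ b_cvg) => k /=.
- exact: normr_ge0.
- exact: le_trans (normr_ge0 _) (cb k).
- exact: cb.
Qed.

Lemma dominated_series_tail (c : R^nat) n : (forall k, `|c k| <= b k) ->
  `|limn (series c) - series c n| <= limn (series b) - series b n.
Proof.
move=> cb; have cc := dominated_series_cvg cb.
have h1 : (fun m => `|series c m - series c n|) @ \oo --> `|limn (series c) - series c n|.
  by apply: cvg_norm; apply: cvgB => //; exact: cvg_cst.
have h2 : (fun m => series b m - series b n) @ \oo --> limn (series b) - series b n.
  by apply: cvgB => //; exact: cvg_cst.
rewrite -(cvg_lim _ h1) // -(cvg_lim _ h2) //; apply: ler_lim.
- by apply/cvg_ex; eexists; exact: h1.
- by apply/cvg_ex; eexists; exact: h2.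
exists n => // m /= nm; rewrite !sub_series nm.
by apply: le_trans (ler_norm_sum _ _ _) _; apply: ler_sum.
Qed.

Lemma dominated_series_le (c : R^nat) : (forall k, `|c k| <= b k) ->
  `|limn (series c)| <= limn (series b).
Proof. by move=> cb; have := dominated_series_tail 0 cb; rewrite /series /= !big_geq // !subr0. Qed.

Lemma series_tail_cvg0 : (fun n => limn (series b) - series b n) @ \oo --> (0 : R).
Proof.
rewrite -[X in _ --> X](subrr (limn (series b))).
by apply: cvgB => //; exact: cvg_cst.
Qed.

End DominatedSeries.

(** * Bessel functions of integer order *)

Section BesselFunctions.
Variables (R : realType) (t : R).
Hypothesis t_ge0 : 0 <= t.

(** The value J_n(2t), see besselJ_bes. *)
Definition bes (n : int) : R := limn (series (fun k => bcoef t k n)).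

Lemma bcoef_exp (rho : R) k n : 0 < rho ->
  `|bcoef t k n| <= rho ^ n * exp_coeff (t * (rho + rho^-1)) k.
Proof. by move=> r0; rewrite /exp_coeff /= mulrA; apply: bcoef_le. Qed.

Lemma bcoef_exp1 k n : `|bcoef t k n| <= exp_coeff (2 * t) k.
Proof.
have := bcoef_exp k n ltr01; rewrite exp1rz mul1r invr1.
by rewrite -[1 + 1]/(2%:R) mulrC.
Qed.

Lemma bes_cvg n : series (fun k => bcoef t k n) @ \oo --> bes n.
Proof.
apply: (dominated_series_cvg (is_cvg_series_exp_coeff (2 * t))) => k; exact: bcoef_exp1.
Qed.

Lemma bes_le (rho : R) n : 0 < rho -> `|bes n| <= rho ^ n * expR (t * (rho + rho^-1)).
Proof.
move=> r0; set a := t * _.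
have h := is_cvg_series_exp_coeff a.
have -> : rho ^ n * expR a = limn (series (rho ^ n *: exp_coeff a)).
  by rewrite lim_seriesZ.
apply: dominated_series_le => [|k]; first exact: is_cvg_seriesZ.
exact: bcoef_exp.
Qed.

(** The constant in bes_le for rho = 1/2. *)
Definition besC : R := expR (t * (2^-1 + 2^-1^-1)).

Lemma besC_ge0 : 0 <= besC. Proof. exact: expR_ge0. Qed.

Lemma bes_decay n : `|bes n| <= 2^-1 ^ n * besC.
Proof. by apply: bes_le; rewrite invr_gt0. Qed.

Lemma bes_decay_shift (n : int) (M : nat) : `|bes (n + M%:Z)| <= (2^-1 ^ n * besC) * 2^-1 ^+ M.
Proof.
apply: le_trans (bes_decay _) _.
by rewrite expfzDr ?invr_eq0 ?pnatr_eq0 // mulrAC.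
Qed.

Lemma bes_cvg0 (n : int) : (fun M : nat => bes (n + M%:Z)) @ \oo --> (0 : R).
Proof.
apply/norm_cvg0P.
apply: (@squeeze_cvgr _ _ _ _ (fun=> 0) (fun M : nat => geometric (2^-1 ^ n * besC) 2^-1 M)).
- by apply: nearW => M; rewrite normr_ge0 /=; exact: bes_decay_shift.
- exact: cvg_cst.
- by apply: cvg_geometric; rewrite ger0_norm ?invr_ge0 // invf_lt1 // ltr1n.
Qed.

Lemma bes_recurrence n : n%:~R * bes n = t * (bes (n - 1) + bes (n + 1)).
Proof.
pose f m := n%:~R * series (fun k => bcoef t k n) m.+1.
pose g m := t * (series (fun k => bcoef t k (n - 1)) m +
    series (fun k => bcoef t k (n + 1)) m).
have h1 : f @ \oo --> n%:~R * bes n.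
  apply: cvgM; first exact: cvg_cst.
  by have := @bes_cvg n; rewrite -cvg_shiftS.
have h2 : g @ \oo --> t * (bes (n - 1) + bes (n + 1)).
  by apply: cvgM; [exact: cvg_cst|apply: cvgD; exact: bes_cvg].
suff fg : f = g by rewrite fg in h1; exact: cvg_unique h1 h2.
apply/funext => m; rewrite /f /g.
rewrite /series /= big_nat_recl // mulrDr [_ * (n == 0)%:R](_ : _ = 0) ?add0r; last first.
  by case: eqP => [->|_]; rewrite ?mul0r ?mulr0.
by rewrite -big_split /= !big_distrr /=; apply: eq_bigr => k _; exact: bcoef_recurrence.
Qed.

Lemma bes_opp n : bes (- n) = (-1) ^ n * bes n.
Proof.
have u_opp k m : bcoef t k (- m) = (-1) ^ m * bcoef t k m.
  elim: k m => [|k IH] m /=.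
    by rewrite oppr_eq0; case: eqP => [->|_]; rewrite ?mulr1 ?mulr0 ?expr0z.
  have -> : - m - 1 = - (m + 1) by lia.
  have -> : - m + 1 = - (m - 1) by lia.
  rewrite !IH !expfzDr ?oppr_eq0 ?oner_eq0 // exprN1 invrN1 expr1z; ring.
pose f m := (-1) ^ n * series (fun k => bcoef t k n) m.
have h : f @ \oo --> (-1) ^ n * bes n.
  by apply: cvgM; [exact: cvg_cst|exact: bes_cvg].
suff fg : f = series (fun k => bcoef t k (- n)).
  by rewrite fg in h; exact: cvg_unique (@bes_cvg (- n)) h.
apply/funext => m; rewrite /f /series /= big_distrr.
by apply: eq_bigr => k _; rewrite u_opp.
Qed.

(** The numerator in the Christoffel-Darboux formula. *)
Definition besW (j k : int) : R := bes j * bes (k + 1) - bes (j + 1) * bes k.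

(** By the three-term recurrence the numerators at consecutive points of a
    diagonal differ by a single product, so sums of products along a diagonal
    telescope. *)
Lemma besW_step j k :
  t * besW j k - t * besW (j + 1) (k + 1) = (j - k)%:~R * (bes (j + 1) * bes (k + 1)).
Proof.
have h1 := bes_recurrence (j + 1); have h2 := bes_recurrence (k + 1).
rewrite !intrD !addrK in h1 h2; rewrite /besW intrB.
transitivity ((j%:~R + 1) * bes (j + 1) * bes (k + 1) - (k%:~R + 1) * bes (k + 1) * bes (j + 1));
  last ring.
by rewrite h1 h2; ring.
Qed.

Lemma besW_sum j k M : (j - k)%:~R * \sum_(0 <= m < M) bes (j + m%:Z + 1) * bes (k + m%:Z + 1) =
  t * besW j k - t * besW (j + M%:Z) (k + M%:Z).
Proof.
elim: M => [|M IH]; first by rewrite big_geq // !addr0 mulr0 subrr.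
rewrite big_nat_recr //= mulrDr IH.
have := besW_step (j + M%:Z) (k + M%:Z).
have -> : j + M%:Z - (k + M%:Z) = j - k by ring.
move=> <-; have e i : i + M.+1%:Z = i + M%:Z + 1 by lia.
by rewrite !e; ring.
Qed.

End BesselFunctions.

Lemma cvg_comp_nat (R : realType) (f : R^nat) (l : R) (K : nat -> nat) :
  (forall M, M <= K M)%N -> f @ \oo --> l -> (fun M => f (K M)) @ \oo --> l.
Proof.
move=> MK fl; apply: (cvg_comp _ _ _ fl) => A [N _ NA].
by exists N => // M /= NM; apply: NA => /=; exact: leq_trans (MK M).
Qed.

(** The term of index m in the Bessel series is the Taylor coefficient of
    degree 2 m + n, and the other coefficients vanish by parity or support.
    The first M terms of the series therefore have the same sum as the
    coefficients of degree below K M. *)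
Lemma besselJ_bes (R : realType) (t : R) (n : int) : 0 <= t -> besselJ n (2 * t) = bes t n.
Proof.
move=> t0; rewrite /besselJ; set c := (fun m : nat => _).
pose K (M : nat) : nat := if 0 <= M%:Z *+ 2 + n then absz (M%:Z *+ 2 + n) else 0%N.
have cE m : c m = if 0 <= m%:Z *+ 2 + n then bcoef t (absz (m%:Z *+ 2 + n)) n else 0.
  rewrite /c; have -> : 2 * t / 2 = t by field.
  have [h|h] := leP 0 (m%:Z *+ 2 + n); last first.
    by have -> : (0 <= m%:Z + n) = false by lia.
  have [k kE] : exists k : nat, m%:Z *+ 2 + n = k by exists (absz (m%:Z *+ 2 + n)); lia.
  rewrite kE absz_nat; have := bcoef_closed t k m%:Z.
  have -> : k%:Z - m%:Z *+ 2 = n by lia.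
  have -> : k%:Z - m%:Z = m%:Z + n by lia.
  move=> ->; rewrite /invfact /=; case: ifP => h2; last by rewrite mulr0.
  by rewrite -!exprnP invfM; ring.
have sE M : series c M = series (fun k => bcoef t k n) (K M).
  elim: M => [|M IH].
    rewrite /series /= big_geq // big_nat big1 // => k /andP[_ kK].
    by apply: bcoef_support; move: kK; rewrite /K; case: ifP => //; lia.
  rewrite seriesSr IH cE /K; have [h|h] := leP 0 (M%:Z *+ 2 + n).
    have [k kE] : exists k : nat, M%:Z *+ 2 + n = k by exists (absz (M%:Z *+ 2 + n)); lia.
    have -> : M.+1%:Z *+ 2 + n = k.+2 by lia.
    rewrite kE !absz_nat /= !seriesSr.
    have -> : bcoef t k.+1 n = 0.
      have -> : n = k.+1%:Z - M.+1%:Z *+ 2 + 1 by lia.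
      exact: bcoef_parity.
    by rewrite addr0.
  rewrite addr0; have [h2|h2] := leP 0 (M.+1%:Z *+ 2 + n); last by [].
  have [h3|h3] := eqVneq (M.+1%:Z *+ 2 + n) 0; first by rewrite h3.
  have -> : M.+1%:Z *+ 2 + n = 1 by lia.
  rewrite /series /= big_geq // big_nat1 /=.
  by have -> : (n == 0) = false by lia.
apply: cvg_lim => //; rewrite -(cvg_shiftn (absz n)).
have -> : (fun M => series c (M + absz n)%N) = (fun M => series (fun k => bcoef t k n) (K (M + absz n)%N)).
  by apply/funext => M; exact: sE.
apply: (@cvg_comp_nat _ _ _ (fun M => K (M + absz n)%N)); last exact: bes_cvg.
by move=> M; rewrite /K; case: ifP => h; lia.
Qed.

Section ChristoffelDarboux.
Variables (R : realType) (t : R).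
Hypothesis t_ge0 : 0 <= t.
Local Notation bes := (bes t).

Lemma bes_product_cvg (j k : int) :
  cvgn (series (fun m : nat => bes (j + m%:Z) * bes (k + m%:Z))).
Proof.
pose D := (2^-1 ^ j * besC t) * (2^-1 ^ k * besC t).
apply: (@dominated_series_cvg _ (geometric D 2^-1)).
  by apply: is_cvg_geometric_series; rewrite ger0_norm ?invr_ge0 // invf_lt1 // ltr1n.
move=> m; rewrite normrM /=.
apply: le_trans (ler_pM _ _ (bes_decay_shift t_ge0 j m) (bes_decay_shift t_ge0 k m)) _ => //.
rewrite mulrACA ler_wpM2l ?mulr_ge0 ?besC_ge0 ?exprz_ge0 ?invr_ge0 //.
rewrite -exprD ler_wiXn2l ?invr_ge0 ?invf_le1 ?ler1n // ?leq_addr //.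
Qed.

(** The Christoffel-Darboux formula: the numerators tend to 0 along the
    diagonal, so the telescoping sum keeps its first term only. *)
Lemma bes_product_sum (j k : int) :
  (j - k)%:~R * limn (series (fun m : nat => bes (j + 1 + m%:Z) * bes (k + 1 + m%:Z))) =
  t * besW t j k.
Proof.
set c := (fun m : nat => _).
pose g M := (j - k)%:~R * series c M.
have h1 : g @ \oo --> (j - k)%:~R * limn (series c).
  by apply: cvgM; [exact: cvg_cst|exact: bes_product_cvg].
pose f (m : nat) := t * besW t j k - t * besW t (j + m%:Z) (k + m%:Z).
have e (i : int) m : i + m%:Z + 1 = i + 1 + m%:Z by lia.
have h2 : f @ \oo --> t * besW t j k.
  rewrite -[X in _ --> X]subr0; apply: cvgB; first exact: cvg_cst.
  rewrite -[X in _ --> X](mulr0 t); apply: cvgM; first exact: cvg_cst.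
  rewrite -[X in _ --> X](subrr (0 * 0)).
  have -> : (fun m : nat => besW t (j + m%:Z) (k + m%:Z)) = (fun m : nat =>
    bes (j + m%:Z) * bes (k + 1 + m%:Z) - bes (j + 1 + m%:Z) * bes (k + m%:Z)).
    by apply/funext => m; rewrite /besW !e.
  by apply: cvgB; apply: cvgM; exact: bes_cvg0.
suff fg : g = f by rewrite fg in h1; exact: cvg_unique h1 h2.
apply/funext => M; rewrite /g /f -besW_sum //; congr (_ * _).
by apply: eq_bigr => m _; rewrite /c !e.
Qed.

End ChristoffelDarboux.

(** * Norm and limits of complex numbers *)

Section ComplexNorm.
Variable R : realType.
Implicit Types z w : R[i].

Lemma normc_normr z : (normc z)%:C = `|z|. Proof. by []. Qed.

Lemma normc_ge0 z : 0 <= normc z.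
Proof. by case: z => x y; rewrite sqrtr_ge0. Qed.

Lemma le_normc_add z w : normc (z + w) <= normc z + normc w.
Proof. by rewrite -lecR rmorphD /= !normc_normr ler_normD. Qed.

Lemma normc_real (a : R) : normc a%:C = `|a|.
Proof. by rewrite /normc /= expr0n addr0 sqrtr_sqr. Qed.

Lemma normc_opp z : normc (- z) = normc z.
Proof. by apply: complexI; rewrite !normc_normr normrN. Qed.

Lemma normc_sum (I : Type) (s : seq I) (P : pred I) (F : I -> R[i]) :
  normc (\sum_(i <- s | P i) F i) <= \sum_(i <- s | P i) normc (F i).
Proof.
elim/big_ind2 : _ => //; first by rewrite normc0.
by move=> x1 x2 y1 y2 h1 h2; apply: le_trans (le_normc_add _ _) _; exact: lerD.
Qed.

Lemma normcX z n : normc (z ^+ n) = normc z ^+ n.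
Proof. by elim: n => [|n IH]; rewrite ?expr0 ?normc1 // !exprS normcM IH. Qed.

Lemma normcXz z (n : int) : normc (z ^ n) = normc z ^ n.
Proof.
by case: n => n; rewrite -?exprnP ?NegzE -?exprnN ?normcV normcX.
Qed.

Lemma normc_nat n : normc (n%:R : R[i]) = n%:R.
Proof. by rewrite -[n%:R in LHS](rmorph_nat (real_complex R)) normc_real ger0_norm. Qed.

Lemma normc_Re z : `|complex.Re z| <= normc z.
Proof. by rewrite -lecR normc_normr normc_ge_Re. Qed.

Lemma normc_Im z : `|complex.Im z| <= normc z.
Proof.
case: z => x y /=; rewrite -(sqrtr_sqr y) ler_wsqrtr // lerDr sqr_ge0 //.
Qed.

Lemma normc_le_ReIm z : normc z <= `|complex.Re z| + `|complex.Im z|.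
Proof.
case: z => x y /=; rewrite -[leRHS]ger0_norm ?addr_ge0 // -sqrtr_sqr ler_wsqrtr //.
by rewrite sqrrD !real_normK ?num_real // addrAC lerDl mulrn_wge0 // mulr_ge0.
Qed.

(** Convergence of complex sequences through the real-valued norm, to which
    real squeeze arguments apply. *)
Definition cvgc (u : nat -> R[i]) (l : R[i]) := (fun n => normc (u n - l)) @ \oo --> (0 : R).

Lemma cvgc_unique u l l' : cvgc u l -> cvgc u l' -> l = l'.
Proof.
move=> h h'; apply/eqP; rewrite -subr_eq0; apply/eqP/eq0_normc.
apply/eqP; rewrite eq_le normc_ge0 andbT.
have hh : (fun n => normc (u n - l) + normc (u n - l')) @ \oo --> (0 + 0 : R).
  exact: cvgD.
rewrite addr0 in hh.
rewrite -(cvg_lim _ hh) //; apply: limr_ge; first by apply/cvg_ex; eexists; exact: hh.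
apply: nearW => n /=.
have -> : l - l' = - (u n - l) + (u n - l') by rewrite opprB addrA subrK.
by apply: le_trans (le_normc_add _ _) _; rewrite normc_opp.
Qed.

Lemma cvgc_le u l (e : R^nat) : (forall n, normc (u n - l) <= e n) ->
  e @ \oo --> (0 : R) -> cvgc u l.
Proof.
move=> h e0; apply: (@squeeze_cvgr _ _ _ _ (fun=> 0) e) => //; last exact: cvg_cst.
by apply: nearW => n; rewrite normc_ge0 h.
Qed.

Lemma cvgc_real (u : R^nat) (l : R) : u @ \oo --> l -> cvgc (fun n => (u n)%:C) l%:C.
Proof.
move=> ul; rewrite /cvgc.
have -> : (fun n => normc ((u n)%:C - l%:C)) = (fun n => `|u n - l|).
  by apply/funext => n; rewrite -rmorphB normc_real.
by apply/norm_cvg0P/subr_cvg0.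
Qed.

Lemma real_cvg_complex (u : R^nat) (l : R) : u @ \oo --> l ->
  (fun n => (u n)%:C : R[i]^o) @ \oo --> (l%:C : R[i]^o).
Proof.
move=> ul; apply/cvgrPdist_lt => e; rewrite ltcE /= => /andP[/eqP eIm e0].
have /cvgrPdist_lt/(_ _ e0) := ul; apply: filterS => n h.
by rewrite -rmorphB -normc_normr normc_real ltcE /= eIm eqxx.
Qed.

End ComplexNorm.

Section ComplexLimits.
Variable R : realType.
Implicit Types (u v : nat -> R[i]) (l : R[i]).

Lemma cvgcD u v l l' : cvgc u l -> cvgc v l' -> cvgc (fun n => u n + v n) (l + l').
Proof.
move=> h h'; apply: (@cvgc_le _ _ _ (fun n => normc (u n - l) + normc (v n - l'))).
  by move=> n; rewrite opprD addrACA; exact: le_normc_add.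
by rewrite -[X in _ --> X]addr0; exact: cvgD.
Qed.

Lemma cvgcZ (c : R[i]) u l : cvgc u l -> cvgc (fun n => c * u n) (c * l).
Proof.
move=> h; apply: (@cvgc_le _ _ _ (fun n => normc c * normc (u n - l))).
  by move=> n; rewrite -mulrBr normcM.
by rewrite -(mulr0 (normc c)); apply: cvgM => //; exact: cvg_cst.
Qed.

Lemma cvgc_cst l : cvgc (fun=> l) l.
Proof. by rewrite /cvgc subrr normc0; exact: cvg_cst. Qed.

Lemma cvgc_sum (I : Type) (s : seq I) (u : I -> nat -> R[i]) (l : I -> R[i]) :
  (forall i, cvgc (u i) (l i)) -> cvgc (fun n => \sum_(i <- s) u i n) (\sum_(i <- s) l i).
Proof.
move=> h; elim: s => [|i s IH].
  by rewrite big_nil; under [X in cvgc X]eq_fun do rewrite big_nil; exact: cvgc_cst.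
rewrite big_cons; under [X in cvgc X]eq_fun do rewrite big_cons.
exact: cvgcD.
Qed.

Lemma cvgc_bound u l (B : R) N : cvgc u l ->
  (forall n, (N <= n)%N -> normc (u n) <= B) -> normc l <= B.
Proof.
move=> h uB.
have h2 : (fun n => B + normc (u n - l)) @ \oo --> (B + 0 : R).
  by apply: cvgD => //; exact: cvg_cst.
rewrite addr0 in h2; rewrite -(cvg_lim _ h2) //; apply: limr_ge.
  by apply/cvg_ex; eexists; exact: h2.
exists N => // n /= Nn; have := le_normc_add (u n) (- (u n - l)).
rewrite normc_opp opprB [u n + _]addrC subrK => /le_trans; apply.
by rewrite lerD2r uB.
Qed.

End ComplexLimits.

(** * The complex exponential as a power series *)

Section ComplexExponential.
Variable R : realType.
Implicit Types z w : R[i].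

Definition exp_sum (F : numFieldType) (n : nat) (a : F) : F := \sum_(k < n) a ^+ k / k`!%:R.

Lemma exp_sumD (F : numFieldType) n (a b : F) :
  exp_sum n (a + b) = \sum_(i < n) \sum_(j < n | (i + j < n)%N) a ^+ i / i`!%:R * (b ^+ j / j`!%:R).
Proof.
pose f i j := a ^+ i / i`!%:R * (b ^+ j / j`!%:R) : F.
transitivity (\sum_(k < n) \sum_(i < n) \sum_(j < n | (i + j == k)%N) f i j).
  apply: eq_bigr => k _; rewrite addrC exprDn big_distrl /=.
  rewrite [RHS](bigID (fun i : 'I_n => (i < k.+1)%N)) /= [X in _ + X]big1 ?addr0; last first.
    move=> i ik; rewrite big1 // => j /eqP ijk; by move: ik; rewrite ltnS -ijk leq_addr.
  rewrite (big_ord_narrow (ltn_ord k)); apply: eq_bigr => i _ /=.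
  have kin : (k - i < n)%N by rewrite (leq_ltn_trans (leq_subr _ _)).
  have ik : (i <= k)%N by rewrite -ltnS.
  rewrite (bigD1 (Ordinal kin)) /=; last by rewrite subnKC.
  rewrite big1 ?addr0 => [|j /andP[/eqP ijk /eqP jn]]; last first.
    by case: jn; apply: val_inj => /=; apply/esym/eqP; rewrite -(eqn_add2l i) subnKC // ijk.
  rewrite /f -[in k`!](bin_fact ik) !natrM mulrnAl -mulr_natr.
  have h m : m`!%:R != 0 :> F by rewrite pnatr_eq0 -lt0n fact_gt0.
  have hb : 'C(k, i)%:R != 0 :> F by rewrite pnatr_eq0 -lt0n bin_gt0.
  by field; rewrite !h hb.
rewrite exchange_big /=; apply: eq_bigr => i _.
rewrite (exchange_big_dep xpredT) //= [RHS]big_mkcond /=; apply: eq_bigr => j _.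
case: ifP => ij; last first.
  by rewrite big1 // => k /eqP kE; move: ij; rewrite kE ltn_ord.
rewrite (bigD1 (Ordinal ij)) //= big1 ?addr0 // => k /andP[/eqP kE /eqP kn].
by case: kn; apply: val_inj.
Qed.

Lemma exp_sum_prod (F : numFieldType) n (a b : F) :
  exp_sum n a * exp_sum n b - exp_sum n (a + b) =
  \sum_(i < n) \sum_(j < n | ~~ (i + j < n)%N) a ^+ i / i`!%:R * (b ^+ j / j`!%:R).
Proof.
rewrite exp_sumD /exp_sum big_distrl /= -sumrB; apply: eq_bigr => i _.
by rewrite big_distrr /= (bigID (fun j : 'I_n => (i + j < n)%N)) /= addrC addrK.
Qed.

Lemma exp_sum_expR (a : R) : (fun n => exp_sum n a) @ \oo --> expR a.
Proof.
have -> : (fun n => exp_sum n a) = series (exp_coeff a).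
  by apply/funext => n; rewrite /series /= big_mkord.
exact: is_cvg_series_exp_coeff.
Qed.

Lemma exp_sum_cos_sin (y : R) : cvgc (fun n => exp_sum n ('i * y%:C)) (cos y +i* sin y).
Proof.
have e n : exp_sum n ('i * y%:C) = series (cos_coeff y) n +i* series (sin_coeff y) n.
  rewrite /exp_sum /series /= !big_mkord.
  elim: n => [|n IH]; first by rewrite !big_ord0.
  rewrite !big_ord_recr /= IH; apply/eqP; rewrite eq_complex /=.
  have -> : ('i * y%:C) ^+ n / n`!%:R =
     cos_coeff y n +i* sin_coeff y n :> R[i].
    rewrite exprMn -rmorphXn -(rmorph_nat (real_complex R)) -fmorphV /=.
    have i2 m : ('i : R[i]) ^+ (m.*2) = ((-1) ^+ m)%:C.
      by rewrite -mul2n exprM sqr_i rmorphXn rmorphN1.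
    rewrite -[in 'i ^+ _](odd_double_half n) exprD i2.
    rewrite /cos_coeff /sin_coeff /=; case: (boolP (odd n)) => on /=.
      have -> : n.-1./2 = n./2 by rewrite -[in LHS](odd_double_half n) on /= doubleK.
      by rewrite expr1; simpc; rewrite -?mulrA.
    by rewrite expr0; simpc; rewrite -?mulrA.
  by rewrite /= !eqxx.
apply: (@cvgc_le _ _ _ (fun n => `|series (cos_coeff y) n - cos y| + `|series (sin_coeff y) n - sin y|)).
  move=> n; rewrite e; apply: le_trans (normc_le_ReIm _) _ => /=; exact: lexx.
rewrite -[X in _ --> X]addr0; apply: cvgD; apply/norm_cvg0P/subr_cvg0.
  by rewrite unlock; exact: is_cvg_series_cos_coeff.
by rewrite unlock; exact: is_cvg_series_sin_coeff.
Qed.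

Lemma exp_sum_normc n z : normc (exp_sum n z) <= exp_sum n (normc z).
Proof.
apply: le_trans (normc_sum _ _ _) _; apply: ler_sum => k _.
by rewrite normcM normcV normcX normc_nat.
Qed.

(** The terms of exp_sum n a * exp_sum n b that are missing in exp_sum n (a +
    b) are dominated by the same terms for the norms of a and b
    (exp_sum_prod), and these tend to 0 because the real exponential is
    multiplicative. For a real and b imaginary, the two factors converge by
    the definitions of expR, cos and sin. *)
Lemma exp_sum_cexp w : cvgc (fun n => exp_sum n w) (cexp w).
Proof.
have split_error (K : comNzRingType) (a b d c s : K) :
  s - d * c = - (a * b - s) + (a * (b - c) + (a - d) * c) by ring.
case: w => x y.
have -> : x +i* y = x%:C + 'i * y%:C :> R[i] by simpc.
set b := 'i * _.
have hb : normc b = `|y| by rewrite /b normcM normc_real /= expr0n add0r expr1n sqrtr1 mul1r.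
have -> : cexp (x%:C + b) = (expR x)%:C * (cos y +i* sin y) by rewrite /cexp /b; simpc.
set c := cos y +i* _.
have h2 : cvgc (fun n => exp_sum n b) c by exact: exp_sum_cos_sin.
have hx n : exp_sum n x%:C = (exp_sum n x)%:C.
  by rewrite /exp_sum rmorph_sum /=; apply: eq_bigr => k _;
     rewrite rmorphM fmorphV rmorphXn rmorph_nat.
have h1 := cvgc_real (@exp_sum_expR x).
pose e n := (exp_sum n `|x| * exp_sum n `|y| - exp_sum n (`|x| + `|y|)) +
  (exp_sum n `|x| * normc (exp_sum n b - c) + normc ((exp_sum n x)%:C - (expR x)%:C) * normc c).
apply: (@cvgc_le _ _ _ e).
  move=> n; pose p := exp_sum n x%:C * exp_sum n b.
  have -> : exp_sum n (x%:C + b) - (expR x)%:C * c = - (p - exp_sum n (x%:C + b)) +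
     (exp_sum n x%:C * (exp_sum n b - c) + ((exp_sum n x)%:C - (expR x)%:C) * c).
    by rewrite /p hx; exact: split_error.
  apply: le_trans (le_normc_add _ _) _; apply: lerD.
    rewrite normc_opp /p !exp_sum_prod.
    apply: le_trans (normc_sum _ _ _) _; apply: ler_sum => i _.
    apply: le_trans (normc_sum _ _ _) _; apply: ler_sum => j _.
    by rewrite !normcM !normcV !normcX !normc_nat normc_real hb.
  apply: le_trans (le_normc_add _ _) _; apply: lerD; last by rewrite normcM.
  rewrite normcM ler_wpM2r ?normc_ge0 //.
  by apply: le_trans (exp_sum_normc _ _) _; rewrite normc_real.
have -> : 0 = (expR `|x| * expR `|y| - expR (`|x| + `|y|)) + (expR `|x| * 0 + 0 * normc c) :> R.
  by rewrite expRD subrr mulr0 mul0r !addr0.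
apply: cvgD; first by apply: cvgB; [apply: cvgM; exact: exp_sum_expR|exact: exp_sum_expR].
apply: cvgD; apply: cvgM => //; [exact: exp_sum_expR|exact: cvg_cst].
Qed.

Lemma cexpD z w : cexp (z + w) = cexp z * cexp w.
Proof.
case: z w => [a b] [c d]; rewrite /cexp /= expRD cosD sinD; simpc; congr (_ +i* _); ring.
Qed.

Lemma cexp0 : cexp (0 : R[i]) = 1.
Proof. by rewrite /cexp /= expR0 cos0 sin0 mul1r. Qed.

End ComplexExponential.

(** * Averages over a circle *)

Section AngularAverage.
Variables (R : realType) (r : R).
Hypothesis r_gt0 : 0 < r.
Implicit Types (F G : R[i] -> R[i]).
Local Notation mu := (@lebesgue_measure R).
Local Notation D := (`[0, 2 * pi : R]%classic).

Definition circ (phi : R) : R[i] := r%:C * cexp ('i * phi%:C).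

Lemma circE phi : circ phi = (r * cos phi) +i* (r * sin phi).
Proof. by rewrite /circ /cexp /=; simpc; rewrite expR0 !mul1r. Qed.

Lemma normc_cos_sin (phi : R) : normc (cos phi +i* sin phi) = 1.
Proof. by rewrite /= cos2Dsin2 sqrtr1. Qed.

Lemma normc_circ phi : normc (circ phi) = r.
Proof.
have -> : circ phi = r%:C * (cos phi +i* sin phi) by rewrite circE; simpc.
by rewrite normcM normc_cos_sin normc_real mulr1 gtr0_norm.
Qed.

(** Bounded measurable functions on the circle of radius r. The class is
    stable under sums, products and uniform limits, and contains the powers of
    w; on it the average is linear and continuous. *)
Definition bdd_meas F := [/\ measurable_fun D (fun phi => complex.Re (F (circ phi))),
  measurable_fun D (fun phi => complex.Im (F (circ phi))) &
  exists B : R, forall w, normc w = r -> normc (F w) <= B].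

(** The mean over the circle. By the parametrization of the circle, circle_int
    r F is the mean of F w * w. *)
Definition cavg F : R[i] := ((2 * pi)^-1)%:C *
  ((\int[mu]_(phi in D) complex.Re (F (circ phi)))%R +i*
   (\int[mu]_(phi in D) complex.Im (F (circ phi)))%R).

Lemma circle_int_cavg F : circle_int r F = cavg (fun w => F w * w).
Proof. by []. Qed.

Lemma eq_cavg F G : (forall w, normc w = r -> F w = G w) -> cavg F = cavg G.
Proof.
move=> FG; have e phi : F (circ phi) = G (circ phi) by rewrite FG // normc_circ.
by rewrite /cavg; congr (_ * (_ +i* _)); apply: eq_Rintegral => phi _; rewrite e.
Qed.

Lemma eq_bdd_meas F G : (forall w, normc w = r -> F w = G w) -> bdd_meas F -> bdd_meas G.
Proof.
move=> FG; have e phi : F (circ phi) = G (circ phi) by rewrite FG // normc_circ.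
move=> [h1 h2 [B h3]]; split.
- by rewrite (_ : (fun _ => _) = (fun phi => complex.Re (F (circ phi)))) //; apply/funext => phi; rewrite e.
- by rewrite (_ : (fun _ => _) = (fun phi => complex.Im (F (circ phi)))) //; apply/funext => phi; rewrite e.
- by exists B => w wr; rewrite -FG // h3.
Qed.

Lemma bdd_meas_cst (c : R[i]) : bdd_meas (fun=> c).
Proof. by split; [exact: measurable_cst|exact: measurable_cst|exists (normc c)]. Qed.

Lemma bdd_measD F G : bdd_meas F -> bdd_meas G -> bdd_meas (fun w => F w + G w).
Proof.
move=> [f1 f2 [B f3]] [g1 g2 [B' g3]]; split.
- rewrite (_ : (fun _ => _) = (fun phi => complex.Re (F (circ phi)) + complex.Re (G (circ phi)))).
    exact: measurable_funD.
  by apply/funext => phi; case: (F _) (G _) => ? ? [].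
- rewrite (_ : (fun _ => _) = (fun phi => complex.Im (F (circ phi)) + complex.Im (G (circ phi)))).
    exact: measurable_funD.
  by apply/funext => phi; case: (F _) (G _) => ? ? [].
- by exists (B + B') => w wr; apply: le_trans (le_normc_add _ _) _; apply: lerD; auto.
Qed.

Lemma bdd_measM F G : bdd_meas F -> bdd_meas G -> bdd_meas (fun w => F w * G w).
Proof.
move=> [f1 f2 [B f3]] [g1 g2 [B' g3]]; split.
- rewrite (_ : (fun _ => _) = (fun phi => complex.Re (F (circ phi)) * complex.Re (G (circ phi)) -
     complex.Im (F (circ phi)) * complex.Im (G (circ phi)))).
    by apply: measurable_funB; apply: measurable_funM.
  by apply/funext => phi; case: (F _) (G _) => ? ? [].
- rewrite (_ : (fun _ => _) = (fun phi => complex.Re (F (circ phi)) * complex.Im (G (circ phi)) +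
     complex.Im (F (circ phi)) * complex.Re (G (circ phi)))).
    by apply: measurable_funD; apply: measurable_funM.
  by apply/funext => phi; case: (F _) (G _) => ? ? [].
- exists (B * B') => w wr; rewrite normcM; apply: ler_pM; rewrite ?normc_ge0 //; auto.
Qed.

Lemma bdd_meas_sum (I : Type) (s : seq I) (F : I -> R[i] -> R[i]) :
  (forall i, bdd_meas (F i)) -> bdd_meas (fun w => \sum_(i <- s) F i w).
Proof.
move=> gF; elim: s => [|i s IH].
  by apply: eq_bdd_meas (bdd_meas_cst 0) => w _; rewrite big_nil.
by apply: eq_bdd_meas (bdd_measD (gF i) IH) => w _; rewrite big_cons.
Qed.

Lemma circle_inv w : normc w = r -> w^-1 = (r ^- 2)%:C * conjc w.
Proof.
move=> wr; have w0 : w != 0.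
  by apply/eqP => h; move: r_gt0; rewrite -wr h normc0 ltxx.
apply: (mulfI w0); rewrite divff // mulrCA.
have -> : w * conjc w = (r ^+ 2)%:C.
  by rewrite -wr rmorphXn /= normc_normr sqr_normc.
by rewrite -rmorphM mulVf // expf_eq0 gt_eqF.
Qed.

Lemma bdd_meas_id : bdd_meas id.
Proof.
have c0 : measurable_fun D (@cos R).
  by apply: measurable_funS (continuous_measurable_fun (@continuous_cos R)).
have s0 : measurable_fun D (@sin R).
  by apply: measurable_funS (continuous_measurable_fun (@continuous_sin R)).
split.
- rewrite (_ : (fun _ => _) = (fun phi => r * cos phi)); last by apply/funext => phi; rewrite circE.
  by apply: measurable_funM => //; exact: measurable_cst.
- rewrite (_ : (fun _ => _) = (fun phi => r * sin phi)); last by apply/funext => phi; rewrite circE.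
  by apply: measurable_funM => //; exact: measurable_cst.
- by exists r => w ->.
Qed.

Lemma bdd_meas_inv : bdd_meas (fun w => w^-1).
Proof.
have [h1 h2 _] := bdd_meas_id.
have h : bdd_meas (fun w => conjc w).
  split.
  - by rewrite (_ : (fun _ => _) = (fun phi => complex.Re (circ phi))) //; apply/funext => phi; rewrite circE.
  - rewrite (_ : (fun _ => _) = (fun phi => - complex.Im (circ phi))).
      exact: measurable_funN.
    by apply/funext => phi; rewrite circE.
  - by exists r => -[x y]; rewrite /= sqrrN => ->.
apply: eq_bdd_meas (bdd_measM (bdd_meas_cst (r ^- 2)%:C) h) => w wr; exact/esym/circle_inv.
Qed.

Lemma bdd_meas_exp F n : bdd_meas F -> bdd_meas (fun w => F w ^+ n).
Proof.
move=> gF; elim: n => [|n IH]; first exact: (bdd_meas_cst 1).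
by apply: eq_bdd_meas (bdd_measM gF IH) => w _; rewrite exprS.
Qed.

Lemma bdd_meas_expz (n : int) : bdd_meas (fun w => w ^ n).
Proof.
case: n => n; first exact: bdd_meas_exp bdd_meas_id.
apply: eq_bdd_meas (bdd_meas_exp n.+1 bdd_meas_inv) => w _.
by rewrite NegzE -exprnN exprVn.
Qed.

Lemma bdd_meas_lim F (G : nat -> R[i] -> R[i]) (e : R^nat) :
  (forall n, bdd_meas (G n)) ->
  (forall n w, normc w = r -> normc (F w - G n w) <= e n) ->
  e @ \oo --> (0 : R) -> bdd_meas F.
Proof.
move=> gG FG e0.
have cv (p : R[i] -> R) : (forall a b, `|p a - p b| <= normc (a - b)) -> forall phi,
    (fun n => p (G n (circ phi))) @ \oo --> p (F (circ phi)).
  move=> hp phi; apply/subr_cvg0/norm_cvg0P.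
  apply: (@squeeze_cvgr _ _ _ _ (fun=> 0) e) => //; last exact: cvg_cst.
  apply: nearW => n; rewrite normr_ge0 distrC /=; apply: le_trans (hp _ _) _.
  by apply: FG; exact: normc_circ.
split.
- apply: (@measurable_fun_cvg _ _ _ _ (fun n phi => complex.Re (G n (circ phi)))).
    by move=> n; have [] := gG n.
  by move=> phi _; apply: (cv (@complex.Re R)) => -[? ?] [? ?]; exact: (normc_Re (_ +i* _)).
- apply: (@measurable_fun_cvg _ _ _ _ (fun n phi => complex.Im (G n (circ phi)))).
    by move=> n; have [] := gG n.
  by move=> phi _; apply: (cv (@complex.Im R)) => -[? ?] [? ?]; exact: (normc_Im (_ +i* _)).
- have [_ _ [B hB]] := gG 0; exists (e 0%N + B) => w wr.
  rewrite -(subrK (G 0 w) (F w)); apply: le_trans (le_normc_add _ _) _.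
  by apply: lerD; [exact: FG|exact: hB].
Qed.

Lemma measurable_period : (R.-ocitv.-measurable).-sigma.-measurable D.
Proof. exact: measurable_itv. Qed.

Lemma measure_period : mu D = (2 * pi)%:E.
Proof. by rewrite lebesgue_measure_itv /= lte_fin mulr_gt0 ?pi_gt0 // oppr0 adde0. Qed.

Lemma bounded_integrable (f : R -> R) (B : R) : measurable_fun D f ->
  (forall phi, `|f phi| <= B) -> mu.-integrable D (EFin \o f).
Proof.
move=> mf fB; apply: measurable_bounded_integrable => //.
  by rewrite [X in (X < _)%E]measure_period ltry.
exists B; split; first exact: num_real.
by move=> M BM phi _ /=; apply: le_trans (fB phi) (ltW BM).
Qed.

Lemma bdd_meas_integrable F : bdd_meas F ->
  mu.-integrable D (EFin \o (fun phi => complex.Re (F (circ phi)))) /\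
  mu.-integrable D (EFin \o (fun phi => complex.Im (F (circ phi)))).
Proof.
move=> [h1 h2 [B hB]]; split; apply: (@bounded_integrable _ B) => // phi.
  by apply: le_trans (normc_Re _) _; apply: hB; exact: normc_circ.
by apply: le_trans (normc_Im _) _; apply: hB; exact: normc_circ.
Qed.

Lemma cavgD F G : bdd_meas F -> bdd_meas G -> cavg (fun w => F w + G w) = cavg F + cavg G.
Proof.
move=> gF gG; rewrite /cavg -mulrDr; congr (_ * _).
have [f1 f2] := bdd_meas_integrable gF; have [g1 g2] := bdd_meas_integrable gG.
have e1 phi : complex.Re (F (circ phi) + G (circ phi)) =
  complex.Re (F (circ phi)) + complex.Re (G (circ phi)) by case: (F _) (G _) => ? ? [].
have e2 phi : complex.Im (F (circ phi) + G (circ phi)) =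
  complex.Im (F (circ phi)) + complex.Im (G (circ phi)) by case: (F _) (G _) => ? ? [].
under eq_Rintegral do rewrite e1; under [X in _ +i* X]eq_Rintegral do rewrite e2.
by rewrite !RintegralD //; exact: measurable_period.
Qed.

Lemma cavgZ (c : R[i]) F : bdd_meas F -> cavg (fun w => c * F w) = c * cavg F.
Proof.
move=> gF; rewrite /cavg mulrCA; congr (_ * _).
have [f1 f2] := bdd_meas_integrable gF; case: c => a b.
have e1 phi : complex.Re ((a +i* b) * F (circ phi)) =
  a * complex.Re (F (circ phi)) - b * complex.Im (F (circ phi)) by case: (F _) => ? ?.
have e2 phi : complex.Im ((a +i* b) * F (circ phi)) =
  a * complex.Im (F (circ phi)) + b * complex.Re (F (circ phi)) by case: (F _) => ? ?.
under eq_Rintegral do rewrite e1; under [X in _ +i* X]eq_Rintegral do rewrite e2.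
have Z (k : R) (f : R -> R) : mu.-integrable D (EFin \o f) ->
  mu.-integrable D (EFin \o (fun phi => k * f phi)).
  by move=> fi; apply: (@integrableZl _ _ _ mu _ measurable_period k _ fi).
rewrite RintegralB ?RintegralD ?RintegralZl //; try exact: measurable_period; try exact: Z.
Qed.

Lemma cavg_sum (I : Type) (s : seq I) (F : I -> R[i] -> R[i]) :
  (forall i, bdd_meas (F i)) -> cavg (fun w => \sum_(i <- s) F i w) = \sum_(i <- s) cavg (F i).
Proof.
move=> gF; elim: s => [|i s IH].
  rewrite big_nil (@eq_cavg _ (fun w => 0 * 1)); last by move=> w _; rewrite big_nil mul0r.
  by rewrite (cavgZ 0 (bdd_meas_cst 1)) mul0r.
rewrite big_cons -IH -cavgD //; last exact: bdd_meas_sum.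
by apply: eq_cavg => w _; rewrite big_cons.
Qed.

(** The factor 2 comes from bounding the real and imaginary parts separately.
    *)
Lemma cavg_le F B : bdd_meas F -> (forall w, normc w = r -> normc (F w) <= B) ->
  normc (cavg F) <= 2 * B.
Proof.
move=> gF FB; have [f1 f2] := bdd_meas_integrable gF.
have pi2 : 0 < 2 * pi :> R by rewrite mulr_gt0 ?pi_gt0.
have aux (f : R -> R) : mu.-integrable D (EFin \o f) -> (forall phi, `|f phi| <= B) ->
   `|(\int[mu]_(phi in D) f phi)%R| <= B * (2 * pi).
  move=> fi fB; apply: le_trans (@le_normr_Rintegral _ _ _ mu D f measurable_period fi) _.
  have -> : B * (2 * pi) = (\int[mu]_(phi in D) (fun=> B) phi)%R.
    by rewrite Rintegral_cst; [rewrite [X in fine X]measure_period|exact: measurable_period].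
  apply: le_Rintegral => //.
  - exact: integrable_norm fi.
  - apply: (@bounded_integrable _ `|B|) => //; exact: measurable_cst.
rewrite /cavg normcM normc_real ger0_norm ?invr_ge0 ?(ltW pi2) //.
rewrite mulrC ler_pdivrMr //; apply: le_trans (normc_le_ReIm _) _ => /=.
have -> : 2 * B * (2 * pi) = B * (2 * pi) + B * (2 * pi) by ring.
apply: lerD; apply: aux => // phi.
- by apply: le_trans (normc_Re _) (FB _ (normc_circ _)).
- by apply: le_trans (normc_Im _) (FB _ (normc_circ _)).
Qed.

Lemma cavg_dist F G (e : R) : bdd_meas F -> bdd_meas G ->
  (forall w, normc w = r -> normc (F w - G w) <= e) ->
  normc (cavg F - cavg G) <= 2 * e.
Proof.
move=> gF gG FG.
have gN : bdd_meas (fun w => -1 * G w) by apply: bdd_measM gG; exact: bdd_meas_cst.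
have -> : cavg F - cavg G = cavg (fun w => F w + -1 * G w).
  by rewrite cavgD // cavgZ // mulN1r.
apply: cavg_le; first exact: bdd_measD.
by move=> w wr; rewrite mulN1r FG.
Qed.

Lemma cavg_lim F (G : nat -> R[i] -> R[i]) (e : R^nat) :
  (forall n, bdd_meas (G n)) ->
  (forall n w, normc w = r -> normc (F w - G n w) <= e n) ->
  e @ \oo --> (0 : R) -> cvgc (fun n => cavg (G n)) (cavg F).
Proof.
move=> gG FG e0; have gF := bdd_meas_lim gG FG e0.
apply: (@cvgc_le _ _ _ (fun n => 2 * e n)); last first.
  by rewrite -(mulr0 2); apply: cvgM => //; exact: cvg_cst.
by move=> n; rewrite -normc_opp opprB; apply: cavg_dist => // w; exact: FG.
Qed.

Lemma circ_expz phi (n : int) : circ phi ^ n = (r ^ n)%:C * (cos (n%:~R * phi) +i* sin (n%:~R * phi)).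
Proof.
have pos m : (cos phi +i* sin phi) ^+ m = cos (m%:R * phi) +i* sin (m%:R * phi).
  elim: m => [|m IH]; first by rewrite mul0r cos0 sin0.
  rewrite exprS IH -[m.+1]add1n natrD mulrDl mul1r cosD sinD; simpc.
  by congr (_ +i* _); ring.
have e : circ phi = r%:C * (cos phi +i* sin phi) by rewrite circE; simpc.
have r0 : r%:C != 0 :> R[i] by rewrite (inj_eq (@complexI R) r 0) gt_eqF.
case: n => n; first by rewrite -exprnP e exprMn pos rmorphXn.
rewrite NegzE -exprnN e exprMn pos invfM -exprnN fmorphV rmorphXn; congr (_ * _).
rewrite intrN mulNr cosN sinN -pmulrn.
apply: (mulfI (_ : cos (n.+1%:R * phi) +i* sin (n.+1%:R * phi) != 0)).
  by apply/eqP => h; have := normc_cos_sin (n.+1%:R * phi); rewrite h normc0 => /eqP; rewrite eq_sym oner_eq0.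
rewrite divff; last first.
  by apply/eqP => h; have := normc_cos_sin (n.+1%:R * phi); rewrite h normc0 => /eqP; rewrite eq_sym oner_eq0.
simpc; rewrite -!expr2 cos2Dsin2; apply/eqP; rewrite eq_complex /= eqxx /=.
by apply/eqP; ring.
Qed.

Lemma cavg_expz (n : int) : cavg (fun w => w ^ n) = (n == 0)%:R.
Proof.
have pi2 : 0 < 2 * pi :> R by rewrite mulr_gt0 ?pi_gt0.
have [->|n0] := eqVneq n 0.
  rewrite /cavg; under eq_Rintegral do rewrite expr0z /=.
  under [X in _ +i* X]eq_Rintegral do rewrite expr0z /=.
  rewrite !Rintegral_cst; try exact: measurable_period.
  rewrite [X in fine X]measure_period.
  rewrite /= mul1r mul0r -rmorphM mulVf ?gt_eqF //.
have nR : n%:~R != 0 :> R by rewrite intr_eq0.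
have e phi : circ phi ^ n = (r ^ n * cos (n%:~R * phi)) +i* (r ^ n * sin (n%:~R * phi)).
  by rewrite circ_expz; simpc.
rewrite /cavg; under eq_Rintegral do rewrite e /=.
under [X in _ +i* X]eq_Rintegral do rewrite e /=.
have FTC (f g : R -> R) : continuous f -> (forall y : R, is_derive y 1 g (f y)) ->
    g (n%:~R * (2 * pi)) = g 0 ->
    (\int[mu]_(phi in D) (r ^ n * f (n%:~R * phi)))%R = 0.
  move=> cf dg gper.
  pose G phi := r ^ n / n%:~R * g (n%:~R * phi).
  have dG (y : R) : is_derive y 1 G (r ^ n * f (n%:~R * y)).
    apply: is_derive_eq.
    by move: (f _) => z; rewrite /GRing.scale /= mulr1; field.
  rewrite /Rintegral (@continuous_FTC2 _ _ G) //.
  - by rewrite /G gper mulr0 subee.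
  - apply: continuous_subspaceT => phi; apply: continuousM; first exact: cvg_cst.
    by apply: continuous_comp; [exact: mulrl_continuous|exact: cf].
  - have cG : continuous G by move=> y; apply: differentiable_continuous; apply/derivable1_diffP; have [] := dG y.
    split; first by move=> y _; have [] := dG y.
    + by apply: cvg_at_right_filter; exact: cG.
    + by apply: cvg_at_left_filter; exact: cG.
  - by move=> y _; rewrite derive1E; have [_ ->] := dG y.
have per (f : R -> R) : (forall x, f (x + pi *+ 2) = f x) -> f (n%:~R * (2 * pi)) = f 0.
  move=> fp0; have fp x : f (x + 2 * pi) = f x by rewrite mulr_natl fp0.
  have pos m x : f (x + m%:R * (2 * pi)) = f x.
    elim: m => [|m IH]; first by rewrite mul0r addr0.
    by rewrite -addn1 natrD mulrDl mul1r addrA fp IH.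
  clear FTC e nR n0; case: n => n; first by rewrite -(add0r (_ * _)) pos.
  by rewrite NegzE intrN mulNr -(pos n.+1) addNr.
rewrite (FTC cos sin (@continuous_cos R) (fun y => is_derive_sin y) (per sin (@sinD2pi R))).
have dNcos (y : R) : is_derive y 1 (fun x => - cos x) (sin y).
  by apply: is_derive_eq; rewrite opprK.
have Ncos : - cos (n%:~R * (2 * pi)) = - cos 0 :> R by rewrite (per cos (@cosD2pi R)).
by rewrite (FTC sin (fun x => - cos x) (@continuous_sin R) dNcos Ncos) mulr0.
Qed.

End AngularAverage.

(** * Laurent expansion of exp (t (w - 1/w)) *)

Section LaurentExpansion.
Variables (R : realType) (t : R).
Hypothesis t_ge0 : 0 <= t.
Local Notation u := (bcoef t).
Implicit Types w : R[i].

Definition laurent_sum (c : int -> R) (M : nat) w : R[i] :=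
  \sum_(0 <= i < M.*2.+1) (c (i%:Z - M%:Z))%:C * w ^ (i%:Z - M%:Z).

(** A walk of k <= M steps stays in the window from - M to M, so the truncated
    sum is complete, and the recursion of bcoef multiplies it by t (w - 1/w) /
    (k + 1). *)
Lemma laurent_bcoef M k w : (k <= M)%N -> w != 0 ->
  laurent_sum (u k) M w = (t%:C * theta w) ^+ k / k`!%:R.
Proof.
move=> kM w0; elim: k kM => [_|k IH kM].
  rewrite /laurent_sum expr0 divr1 (bigD1_seq M) ?iota_uniq //=; last by rewrite mem_index_iota; lia.
  rewrite subrr eqxx expr0z mulr1 big1 ?addr0 // => i iM.
  by rewrite subr_eq0 eqz_nat (negbTE iM) mul0r.
have eX : \sum_(0 <= i < M.*2.+1) (u k (i%:Z - M%:Z - 1))%:C * w ^ (i%:Z - M%:Z) =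
   w * laurent_sum (u k) M w.
  rewrite big_nat_recl // bcoef_support ?mul0r ?add0r; last by lia.
  rewrite /laurent_sum big_nat_recr //= [in X in _ * (_ + X)]bcoef_support ?mul0r ?addr0; last by lia.
  rewrite big_distrr /=; apply: eq_bigr => i _.
  have -> : i.+1%:Z - M%:Z = i%:Z - M%:Z + 1 by lia.
  rewrite addrK expfzDr // expr1z.
  by rewrite [RHS]mulrC -mulrA.
have eY : \sum_(0 <= i < M.*2.+1) (u k (i%:Z - M%:Z + 1))%:C * w ^ (i%:Z - M%:Z) =
   w^-1 * laurent_sum (u k) M w.
  rewrite big_nat_recr //= bcoef_support ?mul0r ?addr0; last by lia.
  rewrite /laurent_sum big_nat_recl // [in X in _ * (X + _)]bcoef_support ?mul0r ?add0r; last by lia.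
  rewrite big_distrr /=; apply: eq_bigr => i _.
  have -> : i.+1%:Z - M%:Z = i%:Z - M%:Z + 1 by lia.
  by rewrite [w ^ (_ + 1)]expfzDr // expr1z [RHS]mulrC -!mulrA divff ?mulr1.
have -> : laurent_sum (u k.+1) M w = (t / k.+1%:R)%:C * (theta w * laurent_sum (u k) M w).
  rewrite /theta mulrBl -eX -eY -sumrB big_distrr /=; apply: eq_bigr => i _.
  by rewrite rmorphM rmorphB /= -mulrA mulrBl.
rewrite IH ?(ltnW kM) // factS natrM invfM exprS rmorphM fmorphV rmorph_nat /=.
by rewrite -!mulrA; congr (_ * _); rewrite mulrCA; congr (_ * _); rewrite mulrCA.
Qed.

Definition laurent_rate (rho : R) := 2 * (t * (rho + rho^-1)).
(** With A = t (rho + 1/rho), a degree k > M contributes at most (2 M + 2) A^k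
    / k! <= 2 (2 A)^k / k! to the error of the truncated Laurent series. *)
Definition laurent_err (rho : R) (M : nat) : R :=
  2 * (expR (laurent_rate rho) - series (exp_coeff (laurent_rate rho)) M.+1).

Lemma laurent_err_cvg rho : laurent_err rho @ \oo --> (0 : R).
Proof.
rewrite -[X in _ --> X](mulr0 2); apply: cvgM; first exact: cvg_cst.
have := series_tail_cvg0 (is_cvg_series_exp_coeff (laurent_rate rho)).
by rewrite -cvg_shiftS.
Qed.

Lemma laurent_errV rho : laurent_err rho^-1 = laurent_err rho.
Proof. by rewrite /laurent_err /laurent_rate invrK [rho^-1 + rho]addrC. Qed.

(** Degree by degree, the truncated Laurent series differs from the
    exponential series only in degrees k > M. *)
Lemma laurent_bes M w : w != 0 ->
  normc (laurent_sum (bes t) M w - cexp (t%:C * theta w)) <= laurent_err (normc w) M.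
Proof.
move=> w0; set rho := normc w; pose A := t * (rho + rho^-1).
have rho0 : 0 < rho.
  rewrite lt_neqAle normc_ge0 andbT; apply: contra_neq w0 => h.
  exact: eq0_normc (esym h).
have A0 : 0 <= A by rewrite mulr_ge0 // addr_ge0 ?invr_ge0 // ltW.
have lim1 : cvgc (fun K => \sum_(0 <= k < K) laurent_sum (u k) M w) (laurent_sum (bes t) M w).
  rewrite /laurent_sum; under [X in cvgc X]eq_fun do rewrite exchange_big /=.
  apply: cvgc_sum => i.
  under [X in cvgc X]eq_fun do rewrite -big_distrl /= -rmorph_sum mulrC.
  rewrite mulrC; apply/cvgcZ/cvgc_real; exact: bes_cvg.
have lim2 := cvgcD lim1 (cvgcZ (-1) (exp_sum_cexp (t%:C * theta w))).
rewrite mulN1r in lim2; apply: (@cvgc_bound _ _ _ _ M.+1 lim2) => K MK.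
have nth : normc (t%:C * theta w) <= A.
  rewrite normcM normc_real ger0_norm // ler_wpM2l //.
  by apply: le_trans (le_normc_add _ _) _; rewrite normc_opp normcV.
rewrite mulN1r /exp_sum -(big_mkord xpredT (fun k => (t%:C * theta w) ^+ k / k`!%:R)) -sumrB.
rewrite (@big_cat_nat _ _ _ M.+1) //= big_nat big1 ?add0r; last first.
  by move=> k /andP[_ kM]; rewrite laurent_bcoef ?subrr.
have ec0 k : 0 <= exp_coeff (laurent_rate rho) k.
  by apply: exp_coeff_ge0; rewrite mulr_ge0.
apply: (@le_trans _ _ (2 * \sum_(M.+1 <= k < K) exp_coeff (laurent_rate rho) k)); last first.
  rewrite ler_wpM2l // -(sub_series_geq _ MK) lerB //.
  by apply: nondecreasing_cvgn_le; [exact: nondecreasing_series|exact: is_cvg_series_exp_coeff].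
apply: le_trans (normc_sum _ _ _) _; rewrite big_distrr /= !big_nat.
apply: ler_sum => k /andP[Mk kK].
have b1 : normc (laurent_sum (u k) M w) <= M.*2.+1%:R * exp_coeff A k.
  apply: le_trans (normc_sum _ _ _) _.
  rewrite -[M.*2.+1 in leRHS]subn0 mulr_natl -sumr_const_nat; apply: ler_sum => i _.
  rewrite normcM normc_real normcXz -/rho.
  have := @bcoef_exp _ t t_ge0 rho^-1 k (i%:Z - M%:Z); rewrite invr_gt0 => /(_ rho0).
  rewrite invrK [rho^-1 + rho]addrC -/A => h.
  apply: le_trans (ler_wpM2r _ h) _; first by rewrite exprz_ge0 // ltW.
  by rewrite mulrAC -expfzMl mulVf ?gt_eqF // exp1rz mul1r.
have b2 : normc ((t%:C * theta w) ^+ k / k`!%:R) <= exp_coeff A k.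
  rewrite normcM normcV normcX normc_nat /exp_coeff /= ler_wpM2r ?invr_ge0 //.
  by rewrite lerXn2r ?nnegrE ?normc_ge0.
apply: le_trans (le_normc_add _ _) _; rewrite normc_opp.
apply: le_trans (lerD b1 b2) _.
rewrite -[X in _ + X]mul1r -mulrDl natr1.
rewrite /exp_coeff /= /laurent_rate -/A [(2 * A) ^+ k]exprMn -!mulrA [leRHS]mulrA.
rewrite ler_wpM2r ?divr_ge0 ?exprn_ge0 // -exprS -natrX ler_nat expnS.
have : (k < 2 ^ k)%N by exact: ltn_expl.
lia.
Qed.

End LaurentExpansion.

(** * The discrete Bessel kernel *)

Section OffDiagonal.
Variables (R : realType) (t : R).
Hypothesis t_ge0 : 0 <= t.
Local Notation bes := (bes t).

(** The discrete Bessel kernel as a sum of products; it is equal to the double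
    contour integral by Lkernel_bes. *)
Definition bessel_kernel (x : int) (j k : nat) : R :=
  limn (series (fun m : nat => bes (j%:Z - x + 2 + m%:Z) * bes (k%:Z - x + 2 + m%:Z))).

Lemma bessel_kernel_offdiag (x : int) (j k : nat) : j != k ->
  bessel_kernel x j k =
  t * (besselJ (j%:Z - x + 1) (2 * t) * besselJ (k%:Z - x + 2) (2 * t)
           - besselJ (j%:Z - x + 2) (2 * t) * besselJ (k%:Z - x + 1) (2 * t))
      / (j%:R - k%:R).
Proof.
move=> jk; rewrite !besselJ_bes //.
have := bes_product_sum t_ge0 (j%:Z - x + 1) (k%:Z - x + 1).
have e (i : int) : i + 1 + 1 = i + 2 by lia.
rewrite /besW !e.
have -> : j%:Z - x + 1 - (k%:Z - x + 1) = j%:Z - k%:Z by lia.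
rewrite intrB -!pmulrn.
move=> <-; rewrite mulrAC divff ?mul1r //.
by rewrite subr_eq0 eqr_nat.
Qed.

End OffDiagonal.

Section BesselKernel.
Variables (R : realType) (t r : R).
Hypotheses (t_ge0 : 0 <= t) (r_gt0 : 0 < r).
Implicit Types w : R[i].
Local Notation bes := (bes t).
Local Notation bessel_kernel := (bessel_kernel t).
Local Notation E := (fun w : R[i] => cexp (- t%:C * theta w)).

Lemma on_circle_neq0 w : normc w = r -> w != 0.
Proof. by move=> wr; apply/eqP => h; move: r_gt0; rewrite -wr h normc0 ltxx. Qed.

Lemma bdd_meas_laurent_sum (c : int -> R) M : bdd_meas r (laurent_sum c M).
Proof. by apply: bdd_meas_sum => // i; apply: bdd_measM => //; [exact: bdd_meas_cst|exact: bdd_meas_expz]. Qed.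

Lemma laurent_bes_inv M w : normc w = r ->
  normc (cexp (- t%:C * theta w) - laurent_sum bes M w^-1) <= laurent_err t r M.
Proof.
move=> wr; have w0 := on_circle_neq0 wr.
have := laurent_bes t_ge0 M (_ : w^-1 != 0); rewrite invr_eq0 => /(_ w0).
rewrite normcV wr laurent_errV -[in normc _]normc_opp opprB.
by have -> : t%:C * theta w^-1 = - t%:C * theta w by rewrite /theta invrK mulNr -mulrN opprB.
Qed.

Lemma bdd_meas_laurent_sum_inv (c : int -> R) M : bdd_meas r (fun w => laurent_sum c M w^-1).
Proof.
apply: bdd_meas_sum => // i; apply: bdd_measM => //; first exact: bdd_meas_cst.
apply: (eq_bdd_meas r_gt0 _ (bdd_meas_expz r_gt0 (- (i%:Z - M%:Z)))) => w _.
by rewrite -invr_expz exprz_inv invr_expz.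
Qed.

Lemma bdd_meas_exp_theta : bdd_meas r E.
Proof.
apply: (@bdd_meas_lim _ _ r_gt0 _ (fun M w => laurent_sum bes M w^-1) (laurent_err t r)).
- by move=> n; exact: bdd_meas_laurent_sum_inv.
- by move=> n w wr; exact: laurent_bes_inv.
- exact: laurent_err_cvg.
Qed.

(** The integral representation of J_n: in the expansion of exp (- t theta w),
    uniform on the circle, the only term whose product with w^n has a nonzero
    mean is J_n w^(-n). *)
Lemma cavg_bes (n : int) : cavg r (fun w => w ^ n * E w) = (bes n)%:C.
Proof.
pose G M w := w ^ n * laurent_sum bes (M + absz n)%N w^-1.
have gG M : bdd_meas r (G M).
  by apply: bdd_measM => //; [exact: bdd_meas_expz|exact: bdd_meas_laurent_sum_inv].
have GE M : cavg r (G M) = (bes n)%:C.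
  pose K := (M + absz n)%N.
  rewrite (@eq_cavg _ _ r_gt0 _ (fun w => \sum_(0 <= i < K.*2.+1)
     (bes (i%:Z - K%:Z))%:C * w ^ (n - (i%:Z - K%:Z)))); last first.
    move=> w wr; rewrite /G /laurent_sum big_distrr /=; apply: eq_bigr => i _.
    by rewrite mulrCA [w ^ (n - _)]expfzDr ?(on_circle_neq0 wr) // exprz_inv.
  rewrite cavg_sum //; last by move=> i; apply: bdd_measM => //; [exact: bdd_meas_cst|exact: bdd_meas_expz].
  rewrite (eq_bigr (fun i : nat => (bes (i%:Z - K%:Z))%:C * (n - (i%:Z - K%:Z) == 0)%:R)); last first.
    by move=> i _; rewrite cavgZ ?cavg_expz //; exact: bdd_meas_expz.
  have [m mE] : exists m : nat, n + K%:Z = m%:Z.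
    by exists (absz (n + K%:Z)); rewrite /K; lia.
  rewrite (bigD1_seq m) ?iota_uniq //=; last by rewrite mem_index_iota /K; lia.
  rewrite -mE addrK subrr eqxx mulr1 big1 ?addr0 // => i im.
  rewrite (_ : (n - (i%:Z - K%:Z) == 0) = false) ?mulr0 //.
  by apply/negbTE; apply: contra im => /eqP h; apply/eqP; lia.
have h := @cavg_lim _ _ r_gt0 (fun w => w ^ n * E w) G
  (fun M => r ^ n * laurent_err t r (M + absz n)%N) gG.
apply: (@cvgc_unique _ (fun M => cavg r (G M))).
  apply: h => [M w wr|].
    rewrite -mulrBr normcM normcXz wr; apply: ler_wpM2l.
      by rewrite exprz_ge0 // ltW.
    exact: laurent_bes_inv.
  rewrite -(mulr0 (r ^ n)); apply: cvgM; first exact: cvg_cst.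
  rewrite (cvg_shiftn (absz n)); exact: laurent_err_cvg.
under [X in cvgc X]eq_fun do rewrite GE; exact: cvgc_cst.
Qed.

(** The translates of the sequence J are orthonormal: take the mean of w^m =
    w^m exp (- t theta w) exp (t theta w) and expand the second exponential.
    *)
Lemma bes_orthonormal (m : int) :
  (fun M => \sum_(0 <= i < M.*2.+1) bes (i%:Z - M%:Z) * bes (i%:Z - M%:Z + m)) @ \oo -->
  ((m == 0)%:R : R).
Proof.
pose G M w := (w ^ m * E w) * laurent_sum bes M w.
have gE := bdd_meas_exp_theta.
have gmE : bdd_meas r (fun w => w ^ m * E w) by apply: bdd_measM => //; exact: bdd_meas_expz.
have gG M : bdd_meas r (G M) by apply: bdd_measM => //; exact: bdd_meas_laurent_sum.
have [_ _ [B hB]] := gmE.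
have h : cvgc (fun M => cavg r (G M)) (cavg r (fun w => w ^ m)).
  apply: (@cavg_lim _ _ r_gt0 _ _ (fun M => `|B| * laurent_err t r M) gG).
    move=> M w wr.
    have EE : cexp (- t%:C * theta w) * cexp (t%:C * theta w) = 1.
      by rewrite -cexpD mulNr addNr cexp0.
    have -> : w ^ m - G M w = w ^ m * cexp (- t%:C * theta w) *
        - (laurent_sum bes M w - cexp (t%:C * theta w)).
      by rewrite opprB mulrBr -[_ * _ * cexp (t%:C * _)]mulrA EE mulr1.
    rewrite normcM normc_opp; apply: ler_pM; rewrite ?normc_ge0 //.
      by apply: le_trans (hB w wr) (ler_norm _).
    by rewrite -wr; apply: laurent_bes => //; exact: on_circle_neq0 wr.
  rewrite -(mulr0 `|B|); apply: cvgM; [exact: cvg_cst|exact: laurent_err_cvg].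
rewrite cavg_expz // in h.
have GE M : cavg r (G M) = (\sum_(0 <= i < M.*2.+1) bes (i%:Z - M%:Z) * bes (i%:Z - M%:Z + m))%:C.
  rewrite (@eq_cavg _ _ r_gt0 _ (fun w => \sum_(0 <= i < M.*2.+1)
     (bes (i%:Z - M%:Z))%:C * (w ^ (i%:Z - M%:Z + m) * E w))); last first.
    move=> w wr; rewrite /G /laurent_sum big_distrr /=; apply: eq_bigr => i _.
    rewrite mulrCA; congr (_ * _); rewrite [w ^ (_ + m)]expfzDr ?(on_circle_neq0 wr) //.
    by rewrite [LHS]mulrC mulrA.
  have gi i : bdd_meas r (fun w => w ^ (i%:Z - M%:Z + m) * E w).
    by apply: bdd_measM => //; exact: bdd_meas_expz.
  rewrite cavg_sum //; last by move=> i; apply: bdd_measM => //; exact: bdd_meas_cst.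
  rewrite rmorph_sum /=; apply: eq_bigr => i _.
  by rewrite cavgZ // cavg_bes rmorphM.
apply/subr_cvg0/norm_cvg0P; move: h; rewrite /cvgc.
have -> : (fun n => normc (cavg r (G n) - (m == 0)%:R)) = (fun n =>
  `|\sum_(0 <= i < n.*2.+1) bes (i%:Z - n%:Z) * bes (i%:Z - n%:Z + m) - (m == 0)%:R|); last by [].
by apply/funext => n; rewrite GE -(rmorph_nat (real_complex R)) -rmorphB normc_real.
Qed.

Hypothesis r_lt1 : r < 1.

Lemma geometric_err (xi zeta : R[i]) M : normc xi = r -> normc zeta = r ->
  normc ((1 - xi * zeta)^-1 - \sum_(0 <= m < M) (xi * zeta) ^+ m) <=
  (1 - r ^+ 2)^-1 * (r ^+ 2) ^+ M.
Proof.
move=> h1 h2; set q := xi * zeta.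
have qn : normc q = r ^+ 2 by rewrite /q normcM h1 h2 expr2.
have r2 : r ^+ 2 < 1 by rewrite exprn_ilt1 // ltW.
have n1 : 1 - r ^+ 2 <= normc (1 - q).
  rewrite lerBlDr -qn -{1}(normc1 R) -{1}(subrK q 1); exact: le_normc_add.
have q1 : 1 - q != 0.
  by apply/eqP => h; move: n1; rewrite h normc0 leNgt subr_gt0 r2.
have -> : (1 - q)^-1 - \sum_(0 <= m < M) q ^+ m = q ^+ M / (1 - q).
  apply: (mulIf q1); rewrite mulrBl mulVf // divfK //.
  have -> : (\sum_(0 <= m < M) q ^+ m) * (1 - q) = 1 - q ^+ M.
    elim: M => [|M IH]; first by rewrite big_geq // mul0r expr0 subrr.
    rewrite big_nat_recr //= mulrDl IH exprS; ring.
  by rewrite opprB addrC subrK.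
rewrite normcM normcV normcX qn mulrC ler_wpM2r ?exprn_ge0 ?(ltW r_gt0) //.
by rewrite lef_pV2 // ?posrE ?subr_gt0 // (lt_le_trans _ n1) // subr_gt0.
Qed.

Lemma geometric_err_cvg (C : R) : (fun M => C * ((1 - r ^+ 2)^-1 * (r ^+ 2) ^+ M)) @ \oo --> (0 : R).
Proof.
have r2 : r ^+ 2 < 1 by rewrite exprn_ilt1 // ltW.
rewrite -[X in _ --> X](mulr0 C); apply: cvgM; first exact: cvg_cst.
rewrite -[X in _ --> X](mulr0 (1 - r ^+ 2)^-1); apply: cvgM; first exact: cvg_cst.
by apply: cvg_expr; rewrite ger0_norm // exprn_ge0 // ltW.
Qed.

Lemma mul_shuffle (K : comNzRingType) (p e x q : K) : p * e * (x * q) = x * (p * q * e).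
Proof. by ring. Qed.

Lemma mul_regroup (K : comNzRingType) (p q e f d v : K) :
  p * q * (e * f) * d * v = p * e * (q * v * f * d).
Proof. by ring. Qed.

Lemma mul_rotate (K : comNzRingType) (p e h x : K) : p * e * h * x = p * x * e * h.
Proof. by ring. Qed.

(** The geometric expansion of 1 / (1 - xi zeta), uniform on the circles
    because r < 1, separates the variables. Its m-th term is the product of
    the integral representations of two Bessel values. *)
Lemma Lkernel_bes (x : int) (j k : nat) : Lkernel r t x j k = (bessel_kernel x j k)%:C.
Proof.
pose a := - x + j%:Z + 1; pose b := - x + k%:Z + 1.
have gE := bdd_meas_exp_theta.
pose Fz xi zeta := zeta ^ (b + 1) * E zeta / (1 - xi * zeta).
pose H xi := cavg r (Fz xi).
pose Gz xi M zeta := (zeta ^ (b + 1) * E zeta) * \sum_(0 <= m < M) (xi * zeta) ^+ m.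
have gbE : bdd_meas r (fun w => w ^ (b + 1) * E w) by apply: bdd_measM => //; exact: bdd_meas_expz.
have [_ _ [B hB]] := gbE.
have gGz xi M : bdd_meas r (Gz xi M).
  apply: bdd_measM => //; apply: bdd_meas_sum => // m; apply: bdd_meas_exp => //.
  by apply: bdd_measM => //; [exact: bdd_meas_cst|exact: bdd_meas_id].
have Fz_err xi M w : normc xi = r -> normc w = r ->
    normc (Fz xi w - Gz xi M w) <= `|B| * ((1 - r ^+ 2)^-1 * (r ^+ 2) ^+ M).
  move=> h1 h2; rewrite /Fz /Gz -mulrBr normcM; apply: ler_pM; rewrite ?normc_ge0 //.
    by apply: le_trans (hB w h2) (ler_norm _).
  exact: geometric_err.
have gFz xi : normc xi = r -> bdd_meas r (Fz xi).
  move=> h1; apply: (bdd_meas_lim r_gt0 (gGz xi) _ (geometric_err_cvg `|B|)).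
  by move=> n w wr; exact: Fz_err.
have cGz xi M : cavg r (Gz xi M) = \sum_(0 <= m < M) (bes (b + 1 + m%:Z))%:C * xi ^ m.
  have gi (m : nat) : bdd_meas r (fun w => w ^ (b + 1 + m%:Z) * E w).
    by apply: bdd_measM => //; exact: bdd_meas_expz.
  rewrite (@eq_cavg _ _ r_gt0 _ (fun w => \sum_(0 <= m < M)
     xi ^+ m * (w ^ (b + 1 + m%:Z) * E w))); last first.
    move=> w wr; rewrite /Gz big_distrr /=; apply: eq_bigr => m _.
    rewrite exprMn [w ^ (_ + m%:Z)](expfzDr (b + 1)) ?(on_circle_neq0 wr) // -exprnP.
    exact: mul_shuffle.
  rewrite cavg_sum //; last by move=> i; apply: bdd_measM => //; exact: bdd_meas_cst.
  by apply: eq_bigr => i _; rewrite cavgZ // cavg_bes mulrC.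
have H_err xi M : normc xi = r -> normc (H xi - \sum_(0 <= m < M) (bes (b + 1 + m%:Z))%:C * xi ^ m)
   <= 2 * `|B| * ((1 - r ^+ 2)^-1 * (r ^+ 2) ^+ M).
  move=> h1; rewrite -cGz -mulrA; apply: cavg_dist => //; first exact: gFz.
  by move=> w wr; exact: Fz_err.
have inner xi : normc xi = r -> circle_int r (fun zeta =>
    xi ^ a * zeta ^ b * cexp (- t%:C * (theta xi + theta zeta)) / (1 - xi * zeta)) =
    xi ^ a * E xi * H xi.
  move=> h1; rewrite circle_int_cavg /H -cavgZ //; last exact: gFz.
  apply: eq_cavg => // w wr; rewrite mulrDr cexpD /Fz (expfzDr b 1) ?(on_circle_neq0 wr) // expr1z.
  exact: mul_regroup.
have gaE : bdd_meas r (fun w => w ^ (a + 1) * E w) by apply: bdd_measM => //; exact: bdd_meas_expz.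
have [_ _ [A hA]] := gaE.
pose Gx M xi := (xi ^ (a + 1) * E xi) * \sum_(0 <= m < M) (bes (b + 1 + m%:Z))%:C * xi ^ m.
have gGx M : bdd_meas r (Gx M).
  apply: bdd_measM => //; apply: bdd_meas_sum => // m; apply: bdd_measM => //; [exact: bdd_meas_cst|exact: bdd_meas_expz].
have cGx M : cavg r (Gx M) = (series (fun m : nat => bes (a + 1 + m%:Z) * bes (b + 1 + m%:Z)) M)%:C.
  have gi (m : nat) : bdd_meas r (fun w => w ^ (a + 1 + m%:Z) * E w).
    by apply: bdd_measM => //; exact: bdd_meas_expz.
  rewrite (@eq_cavg _ _ r_gt0 _ (fun w => \sum_(0 <= m < M)
     (bes (b + 1 + m%:Z))%:C * (w ^ (a + 1 + m%:Z) * E w))); last first.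
    move=> w wr; rewrite /Gx big_distrr /=; apply: eq_bigr => m _.
    rewrite [w ^ (_ + m%:Z)](expfzDr (a + 1)) ?(on_circle_neq0 wr) //.
    exact: mul_shuffle.
  rewrite cavg_sum //; last by move=> i; apply: bdd_measM => //; exact: bdd_meas_cst.
  rewrite rmorph_sum /=; apply: eq_bigr => i _.
  by rewrite cavgZ // cavg_bes rmorphM mulrC.
(* The error on the inner integral is uniform in xi, so the same expansion
   may be used in the outer integral. *)
have lim1 : cvgc (fun M => cavg r (Gx M)) (Lkernel r t x j k).
  have -> : Lkernel r t x j k = cavg r (fun xi => xi ^ (a + 1) * E xi * H xi).
    rewrite /Lkernel circle_int_cavg; apply: eq_cavg => // xi h1.
    rewrite inner // (expfzDr a 1) ?(on_circle_neq0 h1) // expr1z.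
    exact: mul_rotate.
  apply: (cavg_lim r_gt0 gGx _ (geometric_err_cvg (`|A| * (2 * `|B|)))).
  move=> M w wr; rewrite /Gx -mulrBr normcM -mulrA.
  apply: ler_pM; rewrite ?normc_ge0 //; last exact: H_err.
  by apply: le_trans (hA w wr) (ler_norm _).
apply: (cvgc_unique lim1); under [X in cvgc X]eq_fun do rewrite cGx.
apply: cvgc_real.
have -> : bessel_kernel x j k = limn (series (fun m : nat => bes (a + 1 + m%:Z) * bes (b + 1 + m%:Z))).
  rewrite /bessel_kernel; congr (limn (series _)); apply/funext => m.
  by congr (bes _ * bes _); rewrite /a /b; lia.
exact: bes_product_cvg.
Qed.

End BesselKernel.

(** * Configurations as increasing sequences of positions *)

Section Positions.
Variable N : nat.
Implicit Types (X Y : config N) (a b : 'I_N) (i j : int).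

(** The default value of nth is never reached, as there are N positions. *)
Definition pos X a : int := nth 0 (sort <=%R (enum_fset (val X))) a.

Lemma size_pos X : size (sort <=%R (enum_fset (val X))) = N.
Proof. by rewrite size_sort; exact/eqP/(valP X). Qed.

Lemma pos_lt X a b : (pos X a < pos X b) = (a < b)%N.
Proof.
apply: lt_sorted_ltn_nth; rewrite ?inE ?size_pos ?ltn_ord //.
rewrite lt_sorted_uniq_le sort_uniq fset_uniq /=.
by apply: sort_sorted; exact: le_total.
Qed.

Lemma pos_inj X : injective (pos X).
Proof.
move=> a b ab; apply/val_inj/eqP; rewrite eqn_leq leqNgt -(pos_lt X) ab ltxx.
by rewrite leqNgt -(pos_lt X) ab ltxx.
Qed.

Lemma in_posP X i : reflect (exists a, i = pos X a) (i \in val X).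
Proof.
have e : (i \in val X) = (i \in sort <=%R (enum_fset (val X))) by rewrite mem_sort.
rewrite e; apply: (iffP idP) => [/(nthP 0)[m]|[a ->]].
  by rewrite size_pos => mN <-; exists (Ordinal mN).
by apply: mem_nth; rewrite size_pos.
Qed.

Lemma pos_in X a : pos X a \in val X.
Proof. by apply/in_posP; exists a. Qed.

Lemma pos_unique X (f : 'I_N -> int) : (forall a b, (a < b)%N -> f a < f b) ->
  (forall i, i \in val X -> exists a, i = f a) -> f =1 pos X.
Proof.
move=> f_lt fX.
have fi : injective f.
  move=> a b ab; case: (ltngtP a b) => [/f_lt|/f_lt|/val_inj //]; by rewrite ab ltxx.
pose s := [seq f a | a <- enum 'I_N].
have ss : sorted <%R s.
  apply: (@homo_sorted_in _ _ predT f (fun a b : 'I_N => (a < b)%N)).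
  - by move=> a b _ _; exact: f_lt.
  - exact: all_predT.
  - by have := iota_ltn_sorted 0 N; rewrite -val_enum_ord sorted_map.
have sX : sort <=%R (enum_fset (val X)) =i s.
  apply: (uniq_min_size _ _ _).2; first by rewrite sort_uniq fset_uniq.
    by move=> i; rewrite mem_sort => /fX[a ->]; apply: map_f; rewrite mem_enum.
  by rewrite size_pos size_map size_enum_ord.
have -> : pos X = fun a => nth 0 s a.
  apply/funext => a; rewrite /pos; congr nth; apply: lt_sorted_eq => //.
  rewrite lt_sorted_uniq_le sort_uniq fset_uniq /=.
  by apply: sort_sorted; exact: le_total.
move=> a; rewrite (nth_map a) ?size_enum_ord //.
by rewrite nth_ord_enum.
Qed.

Lemma config_pos X Y : pos X =1 pos Y -> X = Y.
Proof.
move=> XY; apply/val_inj/fsetP => i.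
by apply/in_posP/in_posP => -[a ->]; exists a; rewrite XY.
Qed.

Lemma pos_step a : pos (step N) a = a.+1%:Z.
Proof.
apply/esym; apply: (pos_unique (f := fun a : 'I_N => a.+1%:Z)) => [b c bc|i].
  by rewrite ltz_nat ltnS.
rewrite !inE /= => /mapP[m]; rewrite mem_iota add1n => /andP[m0 mN] ->.
have mN' : (m.-1 < N)%N by lia.
by exists (Ordinal mN') => /=; rewrite prednK.
Qed.

Definition moved (v : 'I_N -> int) a (s : int) : 'I_N -> int :=
  fun b => if b == a then v b + s else v b.

(** A hop to an empty neighbouring site keeps the order of the particles. *)
Lemma pos_left X a : pos X a - 1 \notin val X ->
  pos (exchange (pos X a - 1) X) =1 moved (pos X) a (-1).
Proof.
move=> h b; apply/esym; move: b; apply: pos_unique => [b c|i].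
  rewrite -(pos_lt X) /moved; have [->|ba] := eqVneq b a; have [->|ca] := eqVneq c a; try lia.
  move=> h2; rewrite lt_neqAle; apply/andP; split; last lia.
  by apply: contraNneq h => <-; exact: pos_in.
rewrite in_exchange /transpose subrK.
have [-> _|i1] := eqVneq i (pos X a - 1); first by exists a; rewrite /moved eqxx.
have [_|i2] := eqVneq i (pos X a); first by rewrite (negbTE h).
case/in_posP => b ib; exists b; rewrite /moved; case: eqP => // ba.
by rewrite ib ba eqxx in i2.
Qed.

Lemma pos_right X a : pos X a + 1 \notin val X ->
  pos (exchange (pos X a) X) =1 moved (pos X) a 1.
Proof.
move=> h b; apply/esym; move: b; apply: pos_unique => [b c|i].
  rewrite -(pos_lt X) /moved; have [->|ba] := eqVneq b a; have [->|ca] := eqVneq c a; try lia.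
  move=> h2; rewrite lt_neqAle; apply/andP; split; last lia.
  by apply: contraNneq h => ->; exact: pos_in.
rewrite in_exchange /transpose.
have [_|i1] := eqVneq i (pos X a); first by rewrite (negbTE h).
have [-> _|i2] := eqVneq i (pos X a + 1); first by exists a; rewrite /moved eqxx.
case/in_posP => b ib; exists b; rewrite /moved; case: eqP => // ba.
by rewrite ib ba eqxx in i1.
Qed.

End Positions.

(** * The evolution of the amplitudes by determinants *)

Section FreeFermionDeterminant.
Variables (R : realType) (t : R) (N : nat).
Implicit Types (v y : 'I_N -> int).
Local Notation u := (bcoef t).

Definition bpoly (K : nat) (n : int) : {poly R} := \poly_(k < K) u k n.

(** The determinant of the one-particle amplitudes as a polynomial in the
    time. The truncation of the entries at degree K does not affect the
    coefficients of degree below K. *)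
Definition det_poly (K : nat) v : {poly R} :=
  \det (\matrix_(a < N, b < N) bpoly K (v a - b.+1%:Z)).

Lemma deriv_prod_seq (I : eqType) (s : seq I) (p : I -> {poly R}) : uniq s ->
  (\prod_(i <- s) p i)^`() = \sum_(i <- s) (p i)^`() * \prod_(j <- s | j != i) p j.
Proof.
elim: s => [|i s IH] /=; first by rewrite !big_nil -polyC1 derivC.
case/andP => si us; rewrite !big_cons derivM IH // eqxx /=; congr (_ * _ + _).
  by rewrite big_seq [RHS]big_seq_cond; apply: eq_bigl => j; case: eqP => [->|]; rewrite ?(negbTE si) ?andbT ?andbF.
rewrite big_distrr /= big_seq [RHS]big_seq; apply: eq_bigr => j js.
rewrite big_cons ifT; first by rewrite mulrCA.
by apply: contraNneq si => ->.
Qed.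

Lemma coefM_eq (p q s : {poly R}) k : (forall i, (i <= k)%N -> p`_i = q`_i) ->
  (p * s)`_k = (q * s)`_k.
Proof. by move=> pq; rewrite !coefM; apply: eq_bigr => i _; rewrite pq // -ltnS. Qed.

Lemma bpoly_deriv K n i : (i.+1 < K)%N ->
  (bpoly K n)^`()`_i = (t *: (bpoly K (n - 1) - bpoly K (n + 1)))`_i.
Proof.
move=> iK; rewrite coef_deriv coefZ coefB !coef_poly iK (ltnW iK).
by rewrite -mulr_natl bcoefS.
Qed.

(** The derivative of a product of N one-particle amplitudes differentiates
    one factor at a time, and the differential equation of bcoef turns the
    derivative at position v a into the difference of the amplitudes at v a -
    1 and v a + 1. *)
Lemma det_poly_deriv K v k : (k.+1 < K)%N ->
  k.+1%:R * (det_poly K v)`_k.+1 =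
  t * \sum_a ((det_poly K (moved v a (-1)))`_k - (det_poly K (moved v a 1))`_k).
Proof.
move=> kK; rewrite mulr_natl -coef_deriv /det_poly /determinant raddf_sum coef_sum.
have e (s : 'S_N) (w : 'I_N -> int) :
    \prod_a (\matrix_(a, b) bpoly K (w a - b.+1%:Z)) a (s a) = \prod_a bpoly K (w a - (s a).+1%:Z).
  by apply: eq_bigr => a _; rewrite mxE.
have sgnC (s : 'S_N) : (-1) ^+ s = ((-1) ^+ s : R)%:P :> {poly R} by rewrite polyC_exp polyCN.
have m1 w a s (s' : 'S_N) : \prod_b bpoly K (moved w a s b - (s' b).+1%:Z) =
    bpoly K (w a - (s' a).+1%:Z + s) * \prod_(b | b != a) bpoly K (w b - (s' b).+1%:Z).
  rewrite (bigD1 a) //= /moved eqxx; congr (bpoly K _ * _); first by rewrite addrAC.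
  by apply: eq_bigr => b /negbTE ->.
rewrite (eq_bigr (fun a => \sum_(s : 'S_N) (-1) ^+ s *
   (((bpoly K (v a - (s a).+1%:Z - 1) - bpoly K (v a - (s a).+1%:Z + 1)) *
   \prod_(b | b != a) bpoly K (v b - (s b).+1%:Z))`_k))); last first.
  move=> a _; rewrite !coef_sum -sumrB; apply: eq_bigr => s _.
  by rewrite !e sgnC !coefCM -mulrBr -coefB !m1 mulrBl.
rewrite exchange_big mulr_sumr /=; apply: eq_bigr => s _.
rewrite e sgnC derivM derivC mul0r add0r coefCM -big_distrr /= mulrCA; congr (_ * _).
rewrite deriv_prod_seq ?index_enum_uniq // coef_sum mulr_sumr.
apply: eq_bigr => a _; rewrite -coefZ scalerAl; apply: coefM_eq => i ik.
by rewrite bpoly_deriv // (leq_ltn_trans _ kK).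
Qed.

Lemma det_poly_collision K v a b : a != b -> v a = v b -> det_poly K v = 0.
Proof. by move=> ab vab; apply: (determinant_alternate ab) => c; rewrite !mxE vab. Qed.

(** The operator - i t H at zero anisotropy after the change of phase in
    iter_hamiltonian, which makes it real: hops to the left count positively
    and hops to the right negatively. *)
Definition hop (f : config N -> R) (X : config N) : R :=
  t * \sum_a ((if pos X a - 1 \notin val X then f (exchange (pos X a - 1) X) else 0) -
              (if pos X a + 1 \notin val X then f (exchange (pos X a) X) else 0)).

Definition amp (k : nat) : config N -> R :=
  iter k hop (fun X => (X == step N)%:R).

Lemma det_poly0 K (X : config N) : (0 < K)%N ->
  (det_poly K (pos X))`_0 = (X == step N)%:R.
Proof.
move=> K0; rewrite -horner_coef0 /det_poly -horner_evalE -det_map_mx.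
rewrite (_ : map_mx _ _ = \matrix_(a < N, b < N) (pos X a == b.+1%:Z)%:R); last first.
  apply/matrixP => a b; rewrite !mxE /= /horner_eval horner_coef0 coef_poly K0 /=.
  by rewrite subr_eq0.
have [->|XY] := eqVneq X (step N).
  rewrite (_ : \matrix_(_, _) _ = 1%:M) ?det1 //; apply/matrixP => a b.
  by rewrite !mxE pos_step eqz_nat eqSS.
have [a ha] : exists a, forall b : 'I_N, pos X a != b.+1%:Z.
  apply: contrapT => hn; case/eqP: XY.
  have h a : exists b : 'I_N, pos X a = b.+1%:Z.
    apply: contrapT => h; apply: hn; exists a => b.
    by apply/eqP => e; apply: h; exists b.
  apply: config_pos => a; rewrite pos_step; apply/esym.
  move: a; apply: pos_unique => [b c bc|i /in_posP[a ->]]; first by rewrite ltz_nat ltnS.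
  by have [b ->] := h a; exists b.
rewrite (expand_det_row _ a) big1 // => b _.
by rewrite mxE (negbTE (ha b)) mul0r.
Qed.

(** Both sides obey the same recursion: a hop onto an occupied site gives two
    equal rows, so the hops that are excluded in hop contribute nothing to
    det_poly_deriv. *)
Lemma amp_det K k (X : config N) : (k < K)%N ->
  amp k X = k`!%:R * (det_poly K (pos X))`_k.
Proof.
elim: k X => [|k IH] X kK; first by rewrite det_poly0 // mul1r.
rewrite factS mulnC natrM -mulrA det_poly_deriv // mulrCA /= /hop; congr (_ * _).
rewrite big_distrr /=; apply: eq_bigr => a _; rewrite mulrBr.
have kK' := ltnW kK.
have ext v w : v =1 w -> det_poly K v = det_poly K w by move=> /funext ->.
congr (_ - _).
- case: ifP => h; first by rewrite -/(amp k) IH // (ext _ _ (pos_left h)).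
  move/negbFE: h => /in_posP[b hb].
  have ab : a != b by apply/eqP => ab; move: hb; rewrite ab; lia.
  rewrite (@det_poly_collision K _ a b ab) ?coef0 ?mulr0 //.
  by rewrite /moved eqxx eq_sym (negbTE ab).
- case: ifP => h; first by rewrite -/(amp k) IH // (ext _ _ (pos_right h)).
  move/negbFE: h => /in_posP[b hb].
  have ab : a != b by apply/eqP => ab; move: hb; rewrite ab; lia.
  rewrite (@det_poly_collision K _ a b ab) ?coef0 ?mulr0 //.
  by rewrite /moved eqxx eq_sym (negbTE ab).
Qed.

(** A product of series dominated by exp (c s) is dominated by the product of
    these exponentials. *)
Lemma coef_prod_le (c : R) (I : Type) (s : seq I) (p : I -> {poly R}) k : 0 <= c ->
  (forall i k, `|(p i)`_k| <= c ^+ k / k`!%:R) ->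
  `|(\prod_(i <- s) p i)`_k| <= (c *+ size s) ^+ k / k`!%:R.
Proof.
move=> c0 pc; elim: s k => [|i s IH] k.
  rewrite big_nil coef1 /= mulr0n; case: k => [|k]; last by rewrite normr0 expr0n mul0r.
  by rewrite normr1 expr0 divr1.
rewrite big_cons coefM; apply: le_trans (ler_norm_sum _ _ _) _.
rewrite /= mulrSr exprDn big_distrl /=; apply: ler_sum => j _.
rewrite normrM; apply: le_trans (ler_pM _ _ (pc i j) (IH (k - j)%N)) _ => //.
have jk : (j <= k)%N by rewrite -ltnS.
rewrite -(bin_fact jk) !natrM mulrnAl -mulr_natr.
have h m : m`!%:R != 0 :> R by rewrite pnatr_eq0 -lt0n fact_gt0.
have hb : 'C(k, j)%:R != 0 :> R by rewrite pnatr_eq0 -lt0n bin_gt0.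
rewrite le_eqVlt; apply/orP; left; apply/eqP; move: (_ ^+ j) (_ ^+ (k - j)) => p1 p2.
by field; rewrite !h hb.
Qed.

Lemma det_poly_coef_le K v k : 0 <= t ->
  `|(det_poly K v)`_k| <= N`!%:R * exp_coeff (2 * t *+ N) k.
Proof.
move=> t0; rewrite /det_poly /determinant coef_sum.
apply: le_trans (ler_norm_sum _ _ _) _.
have -> : N`! = #|[set: 'S_N]%SET| by rewrite cardsT card_Sn.
rewrite mulr_natl -sumr_const [leRHS](eq_bigl xpredT); last by move=> ?; rewrite inE.
apply: ler_sum => s _.
have -> : (-1) ^+ s = ((-1) ^+ s : R)%:P :> {poly R} by rewrite polyC_exp polyCN.
rewrite coefCM normrM normr_sign mul1r.
have := @coef_prod_le (2 * t) _ (index_enum 'I_N) (fun a : 'I_N => bpoly K (v a - (s a).+1%:Z)) k.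
rewrite -[size _]sum1_size sum1_card card_ord => h.
rewrite (eq_bigr (fun a : 'I_N => bpoly K (v a - (s a).+1%:Z))); last by move=> a _; rewrite mxE.
apply: h => [|a m]; first by rewrite mulr_ge0.
rewrite coef_poly; case: ifP => _; first exact: bcoef_exp1.
by rewrite normr0 divr_ge0 // exprn_ge0 // mulr_ge0.
Qed.

Lemma bpoly_horner1 K n : (bpoly K n).[1] = series (fun k => u k n) K.
Proof.
rewrite /bpoly poly_def horner_sum /series /= big_mkord; apply: eq_bigr => k _.
by rewrite hornerZ hornerXn expr1n mulr1.
Qed.

Definition bes_det v : R := \det (\matrix_(a < N, b < N) bes t (v a - b.+1%:Z)).

Lemma det_cvg (m : nat) (A : nat -> 'M[R]_m) (B : 'M[R]_m) :
  (forall a b, (fun n => A n a b) @ \oo --> B a b) ->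
  (fun n => \det (A n)) @ \oo --> \det B.
Proof.
move=> AB; rewrite /determinant.
apply: cvg_big => [|s _]; first exact: add_continuous.
apply: cvgM; first exact: cvg_cst.
by apply: cvg_big => [|i _]; [exact: mul_continuous|exact: AB].
Qed.

(** At s = 1 the polynomial det_poly n v is the determinant of the truncated
    Bessel series. Its coefficients of degree at least n, which are not part
    of the sum, are bounded by the tail of an exponential series. *)
Lemma det_poly_series v : 0 <= t ->
  (fun n => \sum_(0 <= k < n) (det_poly n v)`_k) @ \oo --> bes_det v.
Proof.
move=> t0.
have h1 : (fun n => (det_poly n v).[1]) @ \oo --> bes_det v.
  rewrite (_ : (fun n => _) = (fun n => \det (\matrix_(a < N, b < N) series (fun k => u k (v a - b.+1%:Z)) n))).
    apply: det_cvg => a b; rewrite mxE (_ : (fun n => _) = series (fun k => u k (v a - b.+1%:Z))).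
      exact: bes_cvg.
    by apply/funext => n; rewrite mxE.
  apply/funext => n; rewrite /det_poly -horner_evalE -det_map_mx; congr determinant.
  by apply/matrixP => a b; rewrite !mxE /= /horner_eval bpoly_horner1.
pose e n := N`!%:R * (expR (2 * t *+ N) - series (exp_coeff (2 * t *+ N)) n).
have h2 : e @ \oo --> (0 : R).
  rewrite -[X in _ --> X](mulr0 N`!%:R); apply: cvgM; first exact: cvg_cst.
  exact: series_tail_cvg0 (is_cvg_series_exp_coeff _).
have c0 : 0 <= 2 * t *+ N by rewrite mulrn_wge0 // mulr_ge0.
suff h3 : (fun n => (det_poly n v).[1] - \sum_(0 <= k < n) (det_poly n v)`_k) @ \oo --> (0 : R).
  rewrite -[X in _ --> X]subr0 (_ : (fun n => _) = (fun n => (det_poly n v).[1] -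
    ((det_poly n v).[1] - \sum_(0 <= k < n) (det_poly n v)`_k))); first exact: cvgB.
  by apply/funext => n; rewrite subKr.
apply/norm_cvg0P; apply: (@squeeze_cvgr _ _ _ _ (fun=> 0) e) => //; last exact: cvg_cst.
apply: nearW => n; rewrite normr_ge0 /=.
set p := det_poly n v; set m := maxn n (size p).
rewrite (@horner_coef_wide _ m) ?leq_maxr // -(big_mkord xpredT (fun i => p`_i * 1 ^+ i)).
rewrite (@big_cat_nat _ _ _ n) ?leq_maxl //=.
rewrite (eq_bigr (fun i => p`_i)) => [|i _]; last by rewrite expr1n mulr1.
rewrite addrC addrK; apply: le_trans (ler_norm_sum _ _ _) _.
apply: (@le_trans _ _ (N`!%:R * \sum_(n <= k < m) exp_coeff (2 * t *+ N) k)).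
  rewrite big_distrr /=; apply: ler_sum => i _.
  by rewrite expr1n mulr1; exact: det_poly_coef_le.
rewrite ler_wpM2l // -(sub_series_geq _ (leq_maxl _ _)) lerB //.
apply: nondecreasing_cvgn_le; last exact: is_cvg_series_exp_coeff.
by apply: nondecreasing_series => k _ _; exact: exp_coeff_ge0.
Qed.

Definition amp_series (X : config N) : R^nat := series (fun k => amp k X / k`!%:R).

Lemma amp_cvg (X : config N) : 0 <= t -> amp_series X @ \oo --> bes_det (pos X).
Proof.
move=> t0; have := @det_poly_series (pos X) t0.
rewrite (_ : (fun n => _) = amp_series X) //; apply/funext => n.
rewrite /amp_series /series /= !big_nat; apply: eq_bigr => k /andP[_ kn].
by rewrite (amp_det X kn) mulrC mulKf.
Qed.

End FreeFermionDeterminant.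

(** * Convergence of the exponential series of the Hamiltonian *)

Lemma esum_le_seq (R : realType) (T : choiceType) (D : set T) (g : T -> R) (b : R) :
  (forall s : seq T, uniq s -> (forall z, z \in s -> D z) -> \sum_(z <- s) g z <= b) ->
  (\esum_(z in D) (g z)%:E <= b%:E)%E.
Proof.
move=> gb; apply: ge_ereal_sup => _ [F [Ff FD] <-].
rewrite fsbig_finite // sumEFin lee_fin; apply: gb => [|z]; first exact: fset_uniq.
by rewrite in_fset_set // inE => /FD.
Qed.

Section Evolution.
Variables (R : realType) (t : R) (N : nat).
Hypothesis t_ge0 : 0 <= t.
Implicit Types (X Y : config N) (f : config N -> R[i]).
Local Notation Y0 := (step N).

Lemma fsum_seq (V : nmodType) (F : int -> V) (r : seq int) : uniq r ->
  (forall j, j \notin r -> F j = 0) -> \sum_(j \in [set: int]) F j = \sum_(j <- r) F j.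
Proof.
move=> ur F0; rewrite (fsbigE r F ur) //; last by move=> j _; exact: F0.
by apply: eq_bigl => j; rewrite in_setT.
Qed.

Lemma fsum_inj (V : nmodType) (F : int -> V) (h : 'I_N -> int) : injective h ->
  (forall j, (forall a, j != h a) -> F j = 0) ->
  \sum_(j \in [set: int]) F j = \sum_a F (h a).
Proof.
move=> hi F0; rewrite (@fsum_seq _ _ [seq h a | a <- enum 'I_N]).
- by rewrite big_map big_enum.
- by rewrite map_inj_uniq ?enum_uniq.
- move=> j jr; apply: F0 => a; apply: contraNneq jr => ->.
  by apply: map_f; rewrite mem_enum.
Qed.

(** Exactly one end of a bond is occupied when its particle can hop to an
    empty site, and at zero anisotropy the bond acts by this hop only. *)
Lemma Hxxz_free f X : Hxxz 0 f X = \sum_a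
  ((if pos X a - 1 \notin val X then f (exchange (pos X a - 1) X) else 0) +
   (if pos X a + 1 \notin val X then f (exchange (pos X a) X) else 0)).
Proof.
pose FL j := if (j \notin val X) && (j + 1 \in val X) then f (exchange j X) else 0.
pose FR j := if (j \in val X) && (j + 1 \notin val X) then f (exchange j X) else 0.
have bE j : bond 0 j f X = FL j + FR j.
  rewrite /bond /FL /FR oppr0 mul0r add0r.
  by case: (j \in _); case: (j + 1 \in _); rewrite /= ?addr0 ?add0r.
have shift_inj : injective (fun a => pos X a - 1) by move=> a b /addIr/pos_inj.
have FL0 j : (forall a, j != pos X a - 1) -> FL j = 0.
  move=> h; rewrite /FL; case: (boolP (j + 1 \in val X)) => [/in_posP[a ja]|]; last by rewrite andbF.
  by have := h a; rewrite -ja addrK eqxx.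
have FR0 j : (forall a, j != pos X a) -> FR j = 0.
  move=> h; rewrite /FR; case: (boolP (j \in val X)) => [/in_posP[a ja]|] //.
  by have := h a; rewrite -ja eqxx.
(* A finite list of bonds outside of which both kinds of hops vanish. *)
pose r := undup ([seq pos X a - 1 | a <- enum 'I_N] ++ [seq pos X a | a <- enum 'I_N]).
have rL j : j \notin r -> FL j = 0.
  rewrite mem_undup mem_cat negb_or => /andP[h _]; apply: FL0 => a.
  by apply: contraNneq h => ->; apply: map_f; rewrite mem_enum.
have rR j : j \notin r -> FR j = 0.
  rewrite mem_undup mem_cat negb_or => /andP[_ h]; apply: FR0 => a.
  by apply: contraNneq h => ->; apply: map_f; rewrite mem_enum.
rewrite /Hxxz (@fsum_seq _ _ r) ?undup_uniq //; last by move=> j jr; rewrite bE rL ?rR ?addr0.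
rewrite (eq_bigr _ (fun j _ => bE j)) big_split /=.
rewrite -(fsum_seq (undup_uniq _) rL) -(fsum_seq (undup_uniq _) rR).
rewrite (fsum_inj shift_inj FL0) (fsum_inj (@pos_inj _ X) FR0) -big_split /=.
apply: eq_bigr => a _; congr (_ + _).
  by rewrite /FL subrK pos_in andbT.
by rewrite /FR pos_in.
Qed.

(** A hop changes the sum of the positions by one, so this factor absorbs the
    powers of - i in the iterates of - i t H. *)
Definition phase X : R[i] := (- 'i) ^ (\sum_a pos X a).

Lemma Ni_neq0 : - 'i != 0 :> R[i].
Proof. by rewrite oppr_eq0 eq_complex /= oner_eq0 andbF. Qed.

Lemma phase_neq0 X : phase X != 0.
Proof. by rewrite expfz_neq0 // Ni_neq0. Qed.

Lemma normc_phase X : normc (phase X) = 1.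
Proof.
rewrite normcXz normc_opp.
have -> : normc ('i : R[i]) = 1 by rewrite /= expr0n add0r expr1n sqrtr1.
by rewrite exp1rz.
Qed.

Lemma sum_moved (v : 'I_N -> int) a s : \sum_b moved v a s b = \sum_b v b + s.
Proof.
rewrite (bigD1 a) //= /moved eqxx [in RHS](bigD1 a) //= addrAC; congr (_ + _ + _).
by apply: eq_bigr => b /negbTE ->.
Qed.

Lemma phase_left X a : pos X a - 1 \notin val X ->
  - 'i * phase (exchange (pos X a - 1) X) = phase X.
Proof.
move=> h; rewrite /phase (eq_bigr _ (fun b _ => pos_left h b)) sum_moved.
by rewrite expfzDr ?Ni_neq0 // exprN1 mulrCA divff ?mulr1 ?Ni_neq0.
Qed.

Lemma phase_right X a : pos X a + 1 \notin val X ->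
  - 'i * phase (exchange (pos X a) X) = - phase X.
Proof.
move=> h; rewrite /phase (eq_bigr _ (fun b _ => pos_right h b)) sum_moved.
by rewrite expfzDr ?Ni_neq0 // expr1z mulrCA mulrNN -expr2 sqr_i mulrN1.
Qed.

Lemma iter_hamiltonian k X :
  iter k (fun f X => - 'i * t%:C * Hxxz 0 f X) (basis_vec R Y0) X =
  phase X / phase Y0 * (amp t k X)%:C.
Proof.
elim: k X => [|k IH] X.
  rewrite /= /basis_vec; have [->|_] := eqVneq X Y0; first by rewrite divff ?phase_neq0 // mulr1.
  by rewrite mulr0.
rewrite iterS Hxxz_free; set w := iter k _ _.
have -> : (amp t k.+1 X)%:C = t%:C * (\sum_a
   ((if pos X a - 1 \notin val X then amp t k (exchange (pos X a - 1) X) else 0) -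
    (if pos X a + 1 \notin val X then amp t k (exchange (pos X a) X) else 0)))%:C.
  by rewrite /amp iterS /hop rmorphM.
rewrite -[- 'i * t%:C * _]mulrA mulrCA [RHS]mulrCA; congr (_ * _).
rewrite rmorph_sum !mulr_sumr; apply: eq_bigr => a _.
rewrite rmorphB mulrDr mulrBr; congr (_ + _).
- case: ifP => h; last by rewrite !mulr0.
  by rewrite /w IH !mulrA phase_left.
- case: ifP => h; last by rewrite !mulr0 oppr0.
  by rewrite /w IH !mulrA phase_right // !mulNr.
Qed.

(** A bound of the l^1 norm, through its finite partial sums. *)
Definition l1_le (f : config N -> R) (b : R) := forall s : seq (config N), uniq s ->
  \sum_(X <- s) `|f X| <= b.

Lemma l1_le_move (f : config N -> R) (b : R) (P : pred (config N)) (e : config N -> config N) :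
  l1_le f b -> {in P &, injective e} -> l1_le (fun X => if P X then f (e X) else 0) b.
Proof.
move=> fb ei s us; rewrite (bigID P) /= [X in _ + X]big1 ?addr0; last first.
  by move=> X /negbTE ->; rewrite normr0.
rewrite (eq_bigr (fun X => `|f (e X)|)); last by move=> X ->.
rewrite -big_filter -(big_map e xpredT (fun Z => `|f Z|)); apply: fb.
rewrite map_inj_in_uniq ?filter_uniq // => X Z; rewrite !mem_filter => /andP[PX _] /andP[PZ _].
exact: ei.
Qed.

(** Moving the particle of a given rank in a given direction is an injective
    map, and there are N ranks and 2 directions. *)
Lemma hop_l1 (f : config N -> R) (b : R) : l1_le f b -> l1_le (hop t f) (2 * t *+ N * b).
Proof.
move=> fb s us.
have mI (a : 'I_N) (s' : int) X Z : moved (pos X) a s' =1 moved (pos Z) a s' -> X = Z.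
  move=> XZ; apply: config_pos => c; have := XZ c; rewrite /moved.
  by case: eqP => // _ /addIr.
pose L a X := if pos X a - 1 \notin val X then f (exchange (pos X a - 1) X) else 0.
pose Rt a X := if pos X a + 1 \notin val X then f (exchange (pos X a) X) else 0.
have Lb a : \sum_(X <- s) `|L a X| <= b.
  apply: (@l1_le_move f b (fun X => pos X a - 1 \notin val X) (fun X => exchange (pos X a - 1) X)) => //.
  move=> X Z hX hZ XZ; apply: (mI a (-1)) => c.
  by rewrite -(pos_left hX) -(pos_left hZ) XZ.
have Rb a : \sum_(X <- s) `|Rt a X| <= b.
  apply: (@l1_le_move f b (fun X => pos X a + 1 \notin val X) (fun X => exchange (pos X a) X)) => //.
  move=> X Z hX hZ XZ; apply: (mI a 1) => c.
  by rewrite -(pos_right hX) -(pos_right hZ) XZ.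
apply: (@le_trans _ _ (\sum_(X <- s) t * \sum_a (`|L a X| + `|Rt a X|))).
  apply: ler_sum => X _; rewrite /hop normrM ger0_norm // ler_wpM2l //.
  apply: le_trans (ler_norm_sum _ _ _) _; apply: ler_sum => a _; exact: ler_normB.
have -> : 2 * t *+ N * b = t * \sum_(a < N) (b + b).
  by rewrite sumr_const card_ord -mulr_natr -[(b + b) *+ N]mulr_natr; ring.
rewrite -mulr_sumr exchange_big /= ler_wpM2l //.
by apply: ler_sum => a _; rewrite big_split /=; apply: lerD.
Qed.

Let C0 : R := 2 * t *+ N.

Lemma C0_ge0 : 0 <= C0. Proof. by rewrite mulrn_wge0 // mulr_ge0. Qed.

Lemma amp_l1 k : l1_le (amp t k) (C0 ^+ k).
Proof.
elim: k => [|k IH].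
  move=> s us; rewrite /= expr0.
  have [ys|ys] := boolP (Y0 \in s).
    rewrite (bigD1_seq Y0) //= eqxx normr1 big1 ?addr0 // => X /negbTE ->.
    by rewrite normr0.
  rewrite big_seq big1 // => X Xs; case: eqP => [XY|_]; last by rewrite normr0.
  by rewrite XY (negbTE ys) in Xs.
by rewrite exprS; exact: hop_l1.
Qed.

Definition amp_tail (n : nat) : R := expR C0 - series (exp_coeff C0) n.

Lemma amp_tail_cvg : amp_tail @ \oo --> (0 : R).
Proof. exact: series_tail_cvg0 (is_cvg_series_exp_coeff C0). Qed.

(** By hop_l1 the term of degree k has l^1 norm at most C0^k / k!; sum over k
    >= n. *)
Lemma amp_tail_l1 n : l1_le (fun X => amp_series t X n - bes_det t (pos X)) (amp_tail n).
Proof.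
move=> s us.
have h1 : (fun m => \sum_(X <- s) `|amp_series t X n - amp_series t X m|) @ \oo -->
    \sum_(X <- s) `|amp_series t X n - bes_det t (pos X)|.
  apply: cvg_big => [|X _]; first exact: add_continuous.
  apply: cvg_norm; apply: cvgB; [exact: cvg_cst|exact: amp_cvg].
rewrite -(cvg_lim _ h1) //; apply: limr_le; first by apply/cvg_ex; eexists; exact: h1.
exists n => // m /= nm.
apply: (@le_trans _ _ (series (exp_coeff C0) m - series (exp_coeff C0) n)); last first.
  rewrite lerB //; apply: nondecreasing_cvgn_le; last exact: is_cvg_series_exp_coeff.
  by apply: nondecreasing_series => k _ _; apply: exp_coeff_ge0; exact: C0_ge0.
rewrite sub_series_geq //.
under eq_bigr do rewrite distrC /amp_series sub_series_geq //.
apply: (@le_trans _ _ (\sum_(X <- s) \sum_(n <= k < m) `|amp t k X / k`!%:R|)).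
  by apply: ler_sum => X _; exact: ler_norm_sum.
rewrite exchange_big /=; apply: ler_sum => k _.
rewrite (eq_bigr (fun X => `|amp t k X| * k`!%:R^-1)) => [|X _]; last first.
  by rewrite normrM [X in _ * X]ger0_norm ?invr_ge0.
by rewrite -mulr_suml /exp_coeff /= ler_wpM2r ?invr_ge0 //; exact: amp_l1.
Qed.

Definition free_wave : wave R N := fun X => phase X / phase Y0 * (bes_det t (pos X))%:C.

Lemma normc_free_wave X : normc (free_wave X) ^+ 2 = bes_det t (pos X) ^+ 2.
Proof.
by rewrite /free_wave !normcM normcV !normc_phase divr1 mul1r normc_real real_normK ?num_real.
Qed.

(** The square of the error is at most amp_tail n times its absolute value,
    since a single value is bounded by the l^1 norm. *)
Lemma free_wave_cvg_l2 :
  cvg_l2 (exp_partial (fun f X => - 'i * t%:C * Hxxz 0 f X) (basis_vec R Y0)) free_wave.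
Proof.
have e n X : normc (exp_partial (fun f X => - 'i * t%:C * Hxxz 0 f X) (basis_vec R Y0) n X
   - free_wave X) = `|amp_series t X n - bes_det t (pos X)|.
  have -> : exp_partial (fun f X => - 'i * t%:C * Hxxz 0 f X) (basis_vec R Y0) n X =
      phase X / phase Y0 * (amp_series t X n)%:C.
    rewrite /exp_partial /amp_series /series /= rmorph_sum mulr_sumr.
    apply: eq_bigr => k _; rewrite iter_hamiltonian rmorphM fmorphV rmorph_nat /=.
    by rewrite mulrC -!mulrA.
  rewrite /free_wave -mulrBr -rmorphB normcM normc_real normcM normcV !normc_phase.
  by rewrite divr1 mul1r.
rewrite /cvg_l2 /sqnorm.
apply: (@squeeze_cvge _ _ _ _ (fun=> 0%E) _ (fun n => (amp_tail n * amp_tail n)%:E)).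
- apply: nearW => n; apply/andP; split.
    by apply: esum_ge0 => X _; rewrite lee_fin exprn_ge0 ?normc_ge0.
  apply: esum_le_seq => s us _.
  under eq_bigr do rewrite e expr2.
  have tb := amp_tail_l1 n us.
  have t0 : 0 <= amp_tail n by have := amp_tail_l1 n (isT : uniq [::]); rewrite big_nil.
  apply: (@le_trans _ _ (\sum_(X <- s) amp_tail n * `|amp_series t X n - bes_det t (pos X)|)).
    apply: ler_sum => X _; rewrite ler_wpM2r //.
    by have := amp_tail_l1 n (isT : uniq [:: X]); rewrite big_seq1.
  by rewrite -mulr_sumr ler_wpM2l.
- exact: cvg_cst.
- apply/cvg_EFin; first by apply: nearW.
  rewrite -[X in _ --> X](mulr0 0); apply: cvgM; exact: amp_tail_cvg.
Qed.

(** Convergence in l^2 implies pointwise convergence. *)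
Lemma cvg_l2_unique (v : nat -> wave R N) (g g' : wave R N) :
  cvg_l2 v g -> cvg_l2 v g' -> g = g'.
Proof.
have pt (h : wave R N) X : cvg_l2 v h -> cvgc (fun n => v n X) (h X).
  move=> vh; have h2 : (fun n => (normc (v n X - h X) ^+ 2)%:E) @ \oo --> 0%E.
    apply: (@squeeze_cvge _ _ _ _ (fun=> 0%E) _ (fun n => sqnorm (fun X => v n X - h X))) => //.
    - apply: nearW => n; rewrite lee_fin exprn_ge0 ?normc_ge0 //=.
      apply: esum_ge; exists [set X]; first by split => // Z _.
      by rewrite fsbig_set1.
    - exact: cvg_cst.
  have h3 : (fun n => normc (v n X - h X) ^+ 2) @ \oo --> (0 : R) by exact: (fine_cvg h2).
  rewrite /cvgc -[X in _ --> X]sqrtr0.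
  rewrite (_ : (fun n => _) = (fun n => Num.sqrt (normc (v n X - h X) ^+ 2))).
    exact: (cvg_comp _ _ h3 (@sqrt_continuous R 0)).
  by apply/funext => n; rewrite sqrtr_sqr ger0_norm ?normc_ge0.
move=> vg vg'; apply/funext => X; exact: cvgc_unique (pt _ X vg) (pt _ X vg').
Qed.

Lemma psi_free : psi 0 t Y0 = free_wave.
Proof.
apply: xget_unique; first exact: free_wave_cvg_l2.
by move=> g gP; exact: cvg_l2_unique gP free_wave_cvg_l2.
Qed.

End Evolution.

(** * Summation over configurations by the Cauchy-Binet formula *)

Lemma seq_le_esum (R : realType) (T : choiceType) (D : set T) (g : T -> R) (s : seq T) :
  uniq s -> (forall z, z \in s -> D z) -> (forall z, 0 <= g z) ->
  ((\sum_(z <- s) g z)%:E <= \esum_(z in D) (g z)%:E)%E.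
Proof.
move=> us sD g0; apply: esum_ge; exists [set` s].
  by split => //; exact: finite_seq.
by rewrite -sumEFin fsbig_seq.
Qed.

Section WindowSum.
Variables (R : realType) (t : R) (N' M' : nat) (x : int).
Local Notation N := N'.+1.
Local Notation M := M'.+1.
Local Notation g X := (bes_det t (pos X) ^+ 2).
Implicit Types (S : {set 'I_M}) (X Z : config N) (a : 'I_N) (i : 'I_M).

Definition shiftZ (i : 'I_M) : int := x + i%:Z.

Lemma shiftZ_inj : injective shiftZ.
Proof. by move=> i j /addrI [] /val_inj. Qed.

Definition window : 'M[R]_(M, N) := \matrix_(m, b) bes t (shiftZ m - b.+1%:Z).

Definition set_enum (S : {set 'I_M}) (a : 'I_N) : 'I_M := nth ord0 (enum S) a.

(** Because of the square, the value does not depend on the chosen enumeration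
    of S (bes_det_sqr). *)
Definition minor_sqr (S : {set 'I_M}) : R :=
  bes_det t (fun a => shiftZ (set_enum S a)) ^+ 2.

Lemma set_enum_inj S : #|S| = N -> injective (set_enum S).
Proof.
move=> cS a b /eqP; rewrite nth_uniq ?enum_uniq -?cardE ?cS //.
by move/eqP/val_inj.
Qed.

Lemma bes_det_sqr (f h : 'I_N -> int) : injective f -> injective h ->
  (forall a, exists b, f a = h b) -> bes_det t f ^+ 2 = bes_det t h ^+ 2.
Proof.
move=> fi hi fh.
exact: (@det_enum_sqr _ _ _ (fun (z : int) (b : 'I_N) => bes t (z - b.+1%:Z)) f h).
Qed.

Lemma set_enum_surj S i : #|S| = N -> i \in S -> exists a, i = set_enum S a.
Proof.
move=> cS; rewrite -mem_enum => /(nthP ord0)[m]; rewrite -cardE cS => mN <-.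
by exists (Ordinal mN).
Qed.

Lemma window_det : \det (window^T *m window) = \sum_(S : {set 'I_M} | #|S| == N) minor_sqr S.
Proof.
have fN : N`!%:R != 0 :> R by rewrite pnatr_eq0 -lt0n fact_gt0.
apply: (mulIf fN); rewrite !mulr_natr -Cauchy_Binet_ffun.
rewrite -(sum_injective_ffun N minor_sqr) [LHS](bigID (fun s : {ffun 'I_N -> 'I_M} => injectiveb s)) /=.
rewrite [X in _ + X]big1 ?addr0 => [|s sni]; last first.
  by rewrite (det_mxsub_noninj (fun m b => window m b) id sni) mulr0.
apply: eq_bigr => s /injectiveP si.
have cS : #|[set s a | a : 'I_N]%SET| = N by rewrite card_imset // card_ord.
have e : \det (\matrix_(a, b) window^T a (s b)) = \det (\matrix_(a, b) window (s a) b).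
  by rewrite -det_tr; congr determinant; apply/matrixP => a b; rewrite !mxE.
rewrite e -expr2 (_ : \det _ = bes_det t (fun a => shiftZ (s a))); last first.
  by congr determinant; apply/matrixP => a b; rewrite !mxE.
apply: bes_det_sqr => [a b /shiftZ_inj/si //|a b /shiftZ_inj/(set_enum_inj cS) //|a].
have sa : s a \in [set s a | a : 'I_N]%SET by apply: imset_f.
by have [b ->] := set_enum_surj cS sa; exists b.
Qed.

Definition occupied (X : config N) : {set 'I_M} := [set i | shiftZ i \in val X]%SET.

Definition in_window (X : config N) := forall a, x <= pos X a < x + M%:Z.

Lemma in_window_pos X a : in_window X -> exists2 i, i \in occupied X & pos X a = shiftZ i.
Proof.
move=> /(_ a) /andP[h1 h2]; have iM : (absz (pos X a - x) < M)%N by lia.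
have e : pos X a = shiftZ (Ordinal iM) by rewrite /shiftZ /=; lia.
by exists (Ordinal iM); rewrite // inE -e pos_in.
Qed.

Lemma occupied_pos X i : i \in occupied X -> exists a, shiftZ i = pos X a.
Proof. by rewrite inE => /in_posP[a]; exists a. Qed.

Lemma card_occupied X : in_window X -> #|occupied X| = N.
Proof.
move=> wX; have h a : exists i, (i \in occupied X) && (pos X a == shiftZ i).
  by have [i iX /eqP pi] := in_window_pos a wX; exists i; rewrite iX.
pose q a := xchoose (h a).
have qP a : pos X a = shiftZ (q a) by have /andP[_ /eqP] := xchooseP (h a).
have qi : injective q by move=> a b ab; apply: (@pos_inj _ X); rewrite !qP ab.
have -> : occupied X = [set q a | a : 'I_N]%SET.
  apply/setP => i; apply/idP/imsetP => [/occupied_pos[a ia]|[a _ ->]].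
    by exists a => //; apply: shiftZ_inj; rewrite ia qP.
  by have /andP[] := xchooseP (h a).
by rewrite card_imset // card_ord.
Qed.

Lemma minor_occupied X : in_window X -> g X = minor_sqr (occupied X).
Proof.
move=> wX; have cX := card_occupied wX; apply: bes_det_sqr.
- exact: pos_inj.
- by move=> a b /shiftZ_inj/(set_enum_inj cX).
- move=> a; have [i iX ->] := in_window_pos a wX.
  by have [b ->] := set_enum_surj cX iX; exists b.
Qed.

Lemma occupied_inj X Z : in_window X -> in_window Z -> occupied X = occupied Z -> X = Z.
Proof.
move=> wX wZ XZ; apply/val_inj/fsetP => z; apply/in_posP/in_posP => -[a ->].
  have [m] := in_window_pos a wX; rewrite XZ => /occupied_pos[b ib] ->.
  by exists b.
have [m] := in_window_pos a wZ; rewrite -XZ => /occupied_pos[b ib] ->.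
by exists b.
Qed.

(** Within the sites x, ..., x + M - 1, configurations correspond injectively
    to sets of N indices, over which window_det sums. *)
Lemma sum_in_window_le (s : seq (config N)) : uniq s -> (forall X, X \in s -> in_window X) ->
  \sum_(X <- s) g X <= \det (window^T *m window).
Proof.
move=> us ws; rewrite window_det big_seq (eq_bigr (fun X => minor_sqr (occupied X))); last first.
  by move=> X Xs; apply: minor_occupied; exact: ws.
rewrite -big_seq -(big_map occupied xpredT minor_sqr).
have ur : uniq [seq occupied X | X <- s].
  rewrite map_inj_in_uniq // => X Z Xs Zs; apply: occupied_inj; exact: ws.
rewrite big_uniq //=.
rewrite [leRHS](bigID (mem [seq occupied X | X <- s])) /=.
rewrite [X in _ <= X + _](eq_bigl (mem [seq occupied X | X <- s])); last first.
  move=> S /=; case: (boolP (S \in _)) => [/mapP[X Xs ->]|]; last by rewrite andbF.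
  by rewrite card_occupied ?eqxx //; exact: ws.
by rewrite lerDl sumr_ge0 // => S _; rewrite sqr_ge0.
Qed.

(** The default configuration is taken only for sets whose cardinality is not
    N. *)
Definition fill (S : {set 'I_M}) : config N :=
  insubd (step N) [fset shiftZ i | i in S]%fset.

Lemma in_fill S z : #|S| = N -> (z \in val (fill S)) = (z \in [fset shiftZ i | i in S]%fset).
Proof.
move=> cS; rewrite /fill val_insubd ifT //.
by rewrite card_imfset //= ?cardE -?cS ?cardE //; exact: shiftZ_inj.
Qed.

Lemma occupied_fill S : #|S| = N -> occupied (fill S) = S.
Proof.
move=> cS; apply/setP => i; rewrite inE in_fill //.
by apply/imfsetP/idP => [[k /= kS /shiftZ_inj ->]|iS] //; exists i.
Qed.

Lemma fill_in_window S : #|S| = N -> in_window (fill S).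
Proof.
move=> cS a; have := pos_in (fill S) a; rewrite in_fill // => /imfsetP[i /= _ ->].
by rewrite /shiftZ; have := ltn_ord i; lia.
Qed.

Lemma window_le_esum : ((\det (window^T *m window))%:E <=
  \esum_(X in [set X : config N | (x <= leftmost X)%R]) (g X)%:E)%E.
Proof.
pose s := map fill (enum [pred A : {set 'I_M} | #|A| == N]).
have -> : \det (window^T *m window) = \sum_(X <- s) g X.
  rewrite window_det /s big_map big_enum_cond /=; apply: eq_big => S; first by rewrite andbT.
  move=> /eqP cS; rewrite minor_occupied ?occupied_fill //; exact: fill_in_window.
apply: seq_le_esum => [|X /mapP[S]|X]; last exact: sqr_ge0.
  rewrite map_inj_in_uniq ?enum_uniq // => S S'; rewrite !mem_enum !inE => /eqP cS /eqP cS' SS.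
  by rewrite -(occupied_fill cS) SS occupied_fill.
rewrite mem_enum inE => /eqP cS -> /=.
have /andP[+ _] := fill_in_window cS ord0.
by rewrite /pos /leftmost -nth0.
Qed.

End WindowSum.

(** * The probability as a finite determinant *)

Section FiniteGapProbability.
Variables (R : realType) (t : R) (N' : nat) (x : int).
Hypothesis t_ge0 : 0 <= t.
Local Notation N := N'.+1.
Local Notation bes := (bes t).

(** The Gram matrix of the translates of J by 1, ..., N, restricted to the
    sites n >= x. *)
Definition gap_gram : 'M[R]_N := \matrix_(a, b)
  limn (series (fun m : nat => bes (x - a.+1%:Z + m%:Z) * bes (x - b.+1%:Z + m%:Z))).

Lemma window_gram_cvg :
  (fun M' => \det ((window t N' M' x)^T *m window t N' M' x)) @ \oo --> \det gap_gram.
Proof.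
apply: det_cvg => a b; rewrite mxE.
pose h (m : nat) := bes (x - a.+1%:Z + m%:Z) * bes (x - b.+1%:Z + m%:Z).
rewrite (_ : (fun M' => _) = (fun M' => series h M'.+1)).
  by rewrite (cvg_shiftS (series h)); exact: bes_product_cvg.
apply/funext => M'; rewrite mxE /series /= big_mkord; apply: eq_bigr => m _.
by rewrite !mxE /h; congr (bes _ * bes _); rewrite /shiftZ; lia.
Qed.

Lemma leftmost_pos (X : config N) a : leftmost X <= pos X a.
Proof.
have -> : leftmost X = pos X ord0 by rewrite /pos /leftmost -nth0.
by rewrite leNgt pos_lt.
Qed.

(** Finite families of configurations to the right of x lie in a window, and
    conversely each window contributes to the sum; hence the sum over all
    configurations is the limit of the window determinants. *)
Lemma prob_gap_gram : prob_leftmost_ge 0 t (step N) x = (\det gap_gram)%:E.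
Proof.
rewrite /prob_leftmost_ge psi_free //.
under eq_esum do rewrite normc_free_wave.
set E := (\esum_(X in _) _)%E; set V := \det gap_gram.
have le1 : (E <= V%:E)%E.
  apply: esum_le_seq => s us sD; rewrite /V -(cvg_lim _ window_gram_cvg) //.
  apply: limr_ge; first by apply/cvg_ex; eexists; exact: window_gram_cvg.
  exists (\sum_(X <- s) \sum_a absz (pos X a - x))%N => // M' /= hM.
  apply: sum_in_window_le => // X Xs a; rewrite (le_trans (sD X Xs)) ?leftmost_pos //=.
  have h1 : (absz (pos X a - x)%R <= \sum_(X <- s) \sum_a absz (pos X a - x)%R)%N.
    rewrite (big_rem X) //= (bigD1 a) //= -addnA leq_addr //.
  have h2 := leq_trans h1 hM; lia.
have ge0 : (0 <= E)%E by apply: esum_ge0 => X _; rewrite lee_fin sqr_ge0.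
have fE : E \is a fin_num by rewrite ge0_fin_numE // (le_lt_trans le1) // ltry.
apply/eqP; rewrite eq_le le1 /= -(fineK fE) lee_fin.
rewrite /V -(cvg_lim _ window_gram_cvg) //; apply: limr_le.
  by apply/cvg_ex; eexists; exact: window_gram_cvg.
apply: nearW => M'; rewrite -lee_fin fineK //; exact: window_le_esum.
Qed.

(** By orthonormality, the sum over the sites n >= x is the identity minus the
    sum over n < x, and the latter is the Bessel kernel up to signs because
    J_(-n) = (-1)^n J_n. *)
Lemma gap_gram_kernel a b :
  gap_gram a b = (a == b)%:R - (-1) ^+ a * bessel_kernel t x a b * (-1) ^+ b.
Proof.
pose c : int := x - a.+1%:Z; pose m : int := a%:Z - b%:Z.
pose s (k : nat) := bes (a%:Z - x + 2 + k%:Z) * bes (b%:Z - x + 2 + k%:Z).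
pose h (k : nat) := bes (x - a.+1%:Z + k%:Z) * bes (x - b.+1%:Z + k%:Z).
(* In the window from - M to M with M = K + B, the first i0 K terms belong to
   the sites n < x and the L K others to the sites n >= x. *)
pose B := (absz c).+1.
pose i0 K := absz ((K + B)%N%:Z + c)%R; pose L K := absz ((K + B)%N%:Z + 1 - c)%R.
pose o M := \sum_(0 <= i < M.*2.+1) bes (i%:Z - M%:Z) * bes (i%:Z - M%:Z + m).
have cut K : o (K + B)%N = (-1) ^+ a * (-1) ^+ b * series s (i0 K) + series h (L K).
  have iL : (K + B)%N.*2.+1 = (L K + i0 K)%N by rewrite /i0 /L /B; lia.
  rewrite /o iL (@big_cat_nat _ _ _ (i0 K)) ?leq_addl //=; congr (_ + _).
    rewrite big_nat_rev /series /= mulr_sumr !big_nat; apply: eq_bigr => k /andP[_ kK].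
    rewrite add0n.
    have -> : (i0 K - k.+1)%N%:Z - (K + B)%N%:Z = - (a%:Z - x + 2 + k%:Z).
      by move: kK; rewrite /i0 /B /c; lia.
    have -> : - (a%:Z - x + 2 + k%:Z) + m = - (b%:Z - x + 2 + k%:Z) by rewrite /m; lia.
    rewrite !bes_opp // mulrACA /s; congr (_ * _).
    rewrite -expfzDr ?oppr_eq0 ?oner_eq0 //.
    have -> : a%:Z - x + 2 + k%:Z + (b%:Z - x + 2 + k%:Z) = (a + b)%N%:Z + 2%N%:Z * (2 - x + k%:Z) by lia.
    by rewrite expfzDr ?oppr_eq0 ?oner_eq0 // -exprz_exp -!exprnP exprD sqrrN expr1n exp1rz mulr1.
  rewrite -{1}[i0 K]add0n big_addn addnK /series /=; apply: eq_bigr => k _.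
  by rewrite /h; congr (bes _ * bes _); rewrite /m /i0 /B /c; lia.
have l1 : (fun K => o (K + B)%N) @ \oo --> ((m == 0)%:R : R).
  by rewrite (cvg_shiftn B o); exact: (@bes_orthonormal R t 1 t_ge0 ltr01).
have l2 : (fun K => (-1) ^+ a * (-1) ^+ b * series s (i0 K) + series h (L K)) @ \oo -->
   (-1) ^+ a * (-1) ^+ b * bessel_kernel t x a b + gap_gram a b.
  apply: cvgD.
    apply: cvgM; first exact: cvg_cst.
    apply: (@cvg_comp_nat _ _ _ i0); last exact: bes_product_cvg.
    by move=> K; rewrite /i0 /B; lia.
  rewrite mxE; apply: (@cvg_comp_nat _ _ _ L); last exact: bes_product_cvg.
  by move=> K; rewrite /L /B; lia.
have e : (fun K => o (K + B)%N) = (fun K => (-1) ^+ a * (-1) ^+ b * series s (i0 K) + series h (L K)).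
  by apply/funext => K; exact: cut.
have : (m == 0)%:R = (-1) ^+ a * (-1) ^+ b * bessel_kernel t x a b + gap_gram a b.
  by rewrite e in l1; exact: cvg_unique l1 l2.
rewrite /m subr_eq0 eqz_nat => ->.
by rewrite mulrAC addrC addKr.
Qed.

Lemma prob_det_kernel : prob_leftmost_ge 0 t (step N) x =
  (\det (1%:M - \matrix_(a < N, b < N) bessel_kernel t x a b))%:E.
Proof.
rewrite prob_gap_gram; congr (_%:E); set A := 1%:M - _.
pose d : 'rV[R]_N := \row_a (-1) ^+ a.
have -> : gap_gram = diag_mx d *m A *m diag_mx d.
  apply/matrixP => a b; rewrite gap_gram_kernel mul_mx_diag mul_diag_mx !mxE.
  rewrite mulrBr mulrBl; congr (_ - _).
  have [->|] := eqVneq a b; last by rewrite mulr0 mul0r.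
  by rewrite mulr1 -expr2 sqrr_sign.
rewrite !det_mulmx mulrAC -expr2 det_diag -prodrXl big1 ?mul1r // => a _.
by rewrite mxE sqrr_sign.
Qed.

End FiniteGapProbability.

(** * Passage to the Fredholm determinant *)

(** Dominated convergence for series. *)
Lemma tannery (R : realType) (f : nat -> R^nat) (g b S : R^nat) :
  cvgn (series b) -> (forall N n, `|f N n| <= b n) ->
  (forall n, (fun N => f N n) @ \oo --> g n) ->
  (forall N, series (f N) @ \oo --> S N) ->
  cvgn (series g) /\ S @ \oo --> limn (series g).
Proof.
move=> cb fb fg fS.
have gb n : `|g n| <= b n.
  have h : (fun N => `|f N n|) @ \oo --> `|g n| by apply: cvg_norm.
  rewrite -(cvg_lim _ h) //; apply: limr_le.
    by apply/cvg_ex; eexists; exact: h.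
  by apply: nearW => N.
have cg := dominated_series_cvg cb gb; split=> //.
pose tau K := limn (series b) - series b K.
have bound K N : `|S N - limn (series g)| <= `|series (f N) K - series g K| + (tau K + tau K).
  have h1 := dominated_series_tail cb K (fb N); rewrite (cvg_lim _ (fS N)) // in h1.
  have h2 := dominated_series_tail cb K gb; rewrite distrC in h2.
  have -> : S N - limn (series g) = (series (f N) K - series g K) +
     ((S N - series (f N) K) + (series g K - limn (series g))) by ring.
  apply: le_trans (ler_normD _ _) _; rewrite lerD2l.
  by apply: le_trans (ler_normD _ _) _; apply: lerD.
apply/cvgrPdist_le => e e0.
have e4 : 0 < e / 4 by rewrite divr_gt0.
have /cvgr0Pnorm_le/(_ _ e4) [K _ hK] := series_tail_cvg0 cb.
have tK : tau K <= e / 4 by apply: le_trans (ler_norm _) (hK K (leqnn K)).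
have lim0 : (fun N => series (f N) K - series g K) @ \oo --> (0 : R).
  rewrite -[X in _ --> X](subrr (series g K)); apply: cvgB; last exact: cvg_cst.
  by rewrite /series /=; apply: cvg_big => [|n _]; [exact: add_continuous|exact: fg].
have e2 : 0 < e / 2 by rewrite divr_gt0.
have /cvgr0Pnorm_le/(_ _ e2) := lim0; apply: filterS => N hN.
rewrite distrC; apply: le_trans (bound K N) _.
have -> : e = e / 2 + (e / 4 + e / 4) by field.
by apply: lerD => //; apply: lerD.
Qed.

Section FfunSums.
Variables (R : realType) (n : nat).
Implicit Types (phi : ('I_n -> nat) -> R).

(** The sum of phi over the points of the discrete cube with side M. *)
Definition ffun_sum phi (M : nat) : R :=
  \sum_(s : {ffun 'I_n -> 'I_M}) phi (fun a => s a).

Lemma ffun_sum_prod (c : R^nat) M :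
  ffun_sum (fun s => \prod_a c (s a)) M = (series c M) ^+ n.
Proof.
rewrite /ffun_sum -(bigA_distr_bigA (fun (a : 'I_n) (k : 'I_M) => c k)) /=.
by rewrite prodr_const card_ord /series /= big_mkord.
Qed.

Lemma ffun_sum_nondecreasing phi : (forall s, 0 <= phi s) ->
  nondecreasing_seq (ffun_sum phi).
Proof.
move=> p0; apply/nondecreasing_seqP => M.
pose h (s : {ffun 'I_n -> 'I_M}) : {ffun 'I_n -> 'I_M.+1} :=
  [ffun a => widen_ord (leqnSn M) (s a)].
have hi : injective h.
  move=> s s' /ffunP ss; apply/ffunP => a; have := ss a; rewrite !ffunE => /(congr1 val) /= e.
  exact: val_inj.
rewrite /ffun_sum (eq_bigr (fun s => phi (fun a => h s a))); last first.
  by move=> s _; congr phi; apply/funext => a; rewrite ffunE.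
rewrite [leRHS](bigID (mem (h @: [set: {ffun 'I_n -> 'I_M}]%SET))) /=.
rewrite [X in _ <= X + _]big_imset /=; last by move=> s s' _ _; exact: hi.
rewrite [X in _ <= X + _](eq_bigl xpredT); last by move=> s; rewrite finset.in_setT.
by rewrite lerDl sumr_ge0.
Qed.

(** Let psi be the dominating product. The sums of phi + psi and of psi
    increase with M and are bounded, so their difference converges. *)
Lemma ffun_sum_cvg phi (c : R^nat) (B : R) : (forall k, 0 <= c k) ->
  (forall M, series c M <= B) -> (forall s, `|phi s| <= \prod_a c (s a)) ->
  cvgn (ffun_sum phi).
Proof.
move=> c0 cB hphi; pose psi s := \prod_(a < n) c (s a).
have psi0 s : 0 <= psi s by apply: prodr_ge0.
have psiB M : ffun_sum psi M <= B ^+ n.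
  rewrite ffun_sum_prod lerXn2r ?nnegrE //; first exact: sumr_ge0.
  exact: le_trans (sumr_ge0 _ _) (cB M).
have mono chi : (forall s, 0 <= chi s) -> (forall s, chi s <= 2 * psi s) -> cvgn (ffun_sum chi).
  move=> chi0 chi2; apply: nondecreasing_is_cvgn; first exact: ffun_sum_nondecreasing.
  exists (2 * B ^+ n) => _ [M _ <-].
  apply: (@le_trans _ _ (2 * ffun_sum psi M)); last by rewrite ler_wpM2l.
  by rewrite /ffun_sum mulr_sumr; apply: ler_sum.
have c1 : cvgn (ffun_sum (fun s => phi s + psi s)).
  apply: mono => s; have := hphi s; rewrite ler_norml => /andP[h1 h2].
    by rewrite -lerBlDr sub0r.
  by rewrite mulr_natl mulr2n lerD2r.
have c2 : cvgn (ffun_sum psi).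
  by apply: mono => // s; rewrite mulr_natl mulr2n lerDl.
have -> : ffun_sum phi = ffun_sum (fun s => phi s + psi s) - ffun_sum psi.
  by apply/funext => M; rewrite fctE /ffun_sum -sumrB; apply: eq_bigr => s _; rewrite addrK.
exact: is_cvgB.
Qed.

End FfunSums.

Section FredholmExpansion.
Variables (R : realType) (L : nat -> nat -> R) (C : R).
Hypothesis C_ge0 : 0 <= C.
Hypothesis L_le : forall j k, `|L j k| <= C * 2^-1 ^+ j * 2^-1 ^+ k.

Definition minor_det n (s : 'I_n -> nat) : R := \det (\matrix_(a < n, b < n) L (s a) (s b)).

(** A minor with a repeated index is zero. Otherwise the n! terms of the
    Leibniz formula are compensated by one of the two factors 2^(- s a), since
    n! <= prod (s a + 1) <= prod 2^(s a) for distinct indices. *)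
Lemma minor_det_le n (s : 'I_n -> nat) : `|minor_det s| <= \prod_a (C * 2^-1 ^+ s a).
Proof.
have [/injectiveP si|sni] := boolP (injectiveb s); last first.
  rewrite /minor_det (det_mxsub_noninj L s sni) normr0.
  by apply: prodr_ge0 => a _; rewrite mulr_ge0 // exprn_ge0 // invr_ge0.
apply: le_trans (det_le (u := fun a => C * 2^-1 ^+ s a) (v := fun b => 2^-1 ^+ s b) _) _.
  by move=> a b; rewrite mxE L_le.
rewrite mulrCA -[leRHS]mulr1 ler_wpM2l //.
  by apply: prodr_ge0 => a _; rewrite mulr_ge0 // exprn_ge0 // invr_ge0.
have e : \prod_(b < n) 2^-1 ^+ s b = (\prod_(b < n) (2 ^ s b)%N)%:R^-1 :> R.
  rewrite natr_prod -prodfV; apply: eq_bigr => b _.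
  by rewrite natrX exprVn.
have p0 : (0 < \prod_(b < n) (2 ^ s b))%N by rewrite prodn_gt0 // => b; rewrite expn_gt0.
rewrite e ler_pdivrMr ?ltr0n // mul1r ler_nat.
apply: leq_trans (fact_le_prod_inj si) _.
by apply: leq_prod => b _; exact: ltn_expl.
Qed.

Definition minor_sum n (M : nat) : R := ffun_sum (@minor_det n) M.

Let c (k : nat) : R := C * 2^-1 ^+ k.

Lemma minor_weight_le M : series c M <= 2 * C.
Proof.
have -> : series c M = C * (2 - 2 * 2^-1 ^+ M).
  rewrite /series /=; elim: M => [|M IH]; first by rewrite big_geq // expr0 mulr1 subrr mulr0.
  by rewrite big_nat_recr //= IH /c exprS; field.
rewrite mulrC ler_wpM2r // gerBl mulr_ge0 // exprn_ge0 // invr_ge0 //.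
Qed.

Lemma minor_sum_le n M : `|minor_sum n M| <= (2 * C) ^+ n.
Proof.
have c0 k : 0 <= c k by rewrite mulr_ge0 // exprn_ge0 // invr_ge0.
apply: le_trans (ler_norm_sum _ _ _) _.
apply: (@le_trans _ _ (ffun_sum (fun s : 'I_n -> nat => \prod_a c (s a)) M)).
  by apply: ler_sum => s _; exact: minor_det_le.
rewrite ffun_sum_prod lerXn2r ?nnegrE ?mulr_ge0 ?sumr_ge0 //.
exact: minor_weight_le.
Qed.

Lemma minor_sum_cvg n : cvgn (minor_sum n).
Proof.
apply: (@ffun_sum_cvg _ _ _ c (2 * C)).
- by move=> k; rewrite mulr_ge0 // exprn_ge0 // invr_ge0.
- exact: minor_weight_le.
- exact: minor_det_le.
Qed.

Definition fredholm_term (n : nat) : R := (-1) ^+ n / n`!%:R * limn (minor_sum n).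

(** The expansion of det (1 - L_N) has terms that are bounded by (2 C)^n / n!,
    uniformly in N, so that the limit may be taken term by term. *)
Lemma det_fredholm_cvg :
  cvgn (series fredholm_term) /\
  (fun N => \det (1%:M - \matrix_(a < N, b < N) L a b)) @ \oo --> limn (series fredholm_term).
Proof.
apply: (@tannery _ (fun N n => (-1) ^+ n / n`!%:R * minor_sum n N) _ (exp_coeff (2 * C))).
- exact: is_cvg_series_exp_coeff.
- move=> N n; rewrite normrM normrM normrX normrN1 expr1n mul1r.
  rewrite ger0_norm ?invr_ge0 // mulrC /exp_coeff /= ler_wpM2r ?invr_ge0 //.
  exact: minor_sum_le.
- move=> n; apply: cvgM; [exact: cvg_cst|exact: minor_sum_cvg].
- move=> N; set S := \det _.
  have e K : (N < K)%N -> series (fun n => (-1) ^+ n / n`!%:R * minor_sum n N) K = S.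
    move=> NK; rewrite /S (@det_1D_expand _ N K _ (fun n => n`!%:R^-1)) //; last first.
      by move=> n; rewrite mulVf // pnatr_eq0 -lt0n fact_gt0.
    rewrite /series /= big_mkord; apply: eq_bigr => n _.
    rewrite [_ / _]mulrC -mulrA; congr (_ * _).
    rewrite /minor_sum /ffun_sum mulr_sumr; apply: eq_bigr => s _.
    rewrite (_ : \matrix_(a, b) _ = -1 *: \matrix_(a, b) L (s a) (s b)); last first.
      by apply/matrixP => a b; rewrite !mxE mulN1r.
    by rewrite detZ.
  apply: cvg_near_cst; exists N.+1 => // K /= NK; exact: e.
Qed.

Lemma fredholm_minors_real n :
  fredholm_minors (fun j k => (L j k)%:C) n = (limn (minor_sum n))%:C.
Proof.
apply: cvg_lim; first exact: norm_hausdorff.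
rewrite (_ : (fun M => _) = (fun M => (minor_sum n M)%:C)).
  exact: real_cvg_complex (@minor_sum_cvg n).
apply/funext => M; rewrite /minor_sum /ffun_sum rmorph_sum; apply: eq_bigr => s _.
rewrite /minor_det -det_map_mx; congr determinant.
by apply/matrixP => a b; rewrite !mxE.
Qed.

Lemma fredholm_det_real :
  fredholm_det (fun j k => (L j k)%:C) = (limn (series fredholm_term))%:C.
Proof.
apply: cvg_lim; first exact: norm_hausdorff.
rewrite (_ : series _ = (fun K => (series fredholm_term K)%:C)).
  by apply: real_cvg_complex; have [] := det_fredholm_cvg.
apply/funext => K; rewrite /series /= rmorph_sum; apply: eq_bigr => n _.
rewrite fredholm_minors_real /fredholm_term rmorphM rmorphM fmorphV rmorph_nat.
by rewrite rmorphXn rmorphN1.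
Qed.

End FredholmExpansion.

Section BesselKernelBound.
Variables (R : realType) (t : R) (x : int).
Hypothesis t_ge0 : 0 <= t.

Definition kernel_const : R := 2 * (2^-1 ^ (2 - x) * besC t) ^+ 2.

Lemma kernel_const_ge0 : 0 <= kernel_const.
Proof. by rewrite mulr_ge0 // sqr_ge0. Qed.

Lemma bessel_kernel_le j k :
  `|bessel_kernel t x j k| <= kernel_const * 2^-1 ^+ j * 2^-1 ^+ k.
Proof.
set D := 2^-1 ^ (2 - x) * besC t.
pose w := D ^+ 2 * 2^-1 ^+ j * 2^-1 ^+ k.
have D0 : 0 <= D by rewrite mulr_ge0 ?besC_ge0 // exprz_ge0 // invr_ge0.
have h0 : `|2^-1 : R| < 1 by rewrite ger0_norm ?invr_ge0 // invf_lt1 // ltr1n.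
have i0 n : 0 <= 2^-1 ^+ n :> R by rewrite exprn_ge0 // invr_ge0.
have gs : series (geometric w 2^-1) @ \oo --> kernel_const * 2^-1 ^+ j * 2^-1 ^+ k.
  have := @cvg_geometric_series _ w 2^-1 h0.
  by have -> : w * (1 - 2^-1)^-1 = kernel_const * 2^-1 ^+ j * 2^-1 ^+ k by rewrite /w /kernel_const -/D; field.
rewrite -(cvg_lim _ gs) //; apply: dominated_series_le.
  by apply/cvg_ex; eexists; exact: gs.
move=> m; rewrite normrM /geometric /=.
have b (i : nat) : `|bes t (i%:Z - x + 2 + m%:Z)| <= D * 2^-1 ^+ i * 2^-1 ^+ m.
  have := bes_decay_shift t_ge0 (2 - x) (i + m).
  have -> : 2 - x + (i + m)%N%:Z = i%:Z - x + 2 + m%:Z by lia.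
  by rewrite exprD mulrA.
apply: le_trans (ler_pM _ _ (b j) (b k)) _ => //.
have -> : D * 2^-1 ^+ j * 2^-1 ^+ m * (D * 2^-1 ^+ k * 2^-1 ^+ m) =
  w * 2^-1 ^+ m * 2^-1 ^+ m by rewrite /w; ring.
have w0 : 0 <= w by rewrite mulr_ge0 // mulr_ge0 // sqr_ge0.
rewrite -[leRHS]mulr1; apply: ler_wpM2l; first by rewrite mulr_ge0.
by rewrite exprn_ile1 ?invr_ge0 // invf_le1 // ler1n.
Qed.

End BesselKernelBound.

Theorem mainTheorem5 (R : realType) (t : R) (x : int) (r : R)
    (t_gt0 : 0 < t) (x_le1 : (x <= 1)%R) (r_gt0 : 0 < r) (r_lt1 : r < 1) :
  (exists d : R, fredholm_det (Lkernel r t x) = d%:C /\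
     prob_leftmost_ge 0 t (step N) x @[N --> \oo] --> d%:E) /\
  (forall j k : nat, j != k ->
     Lkernel r t x j k =
     (t * (besselJ (j%:Z - x + 1) (2 * t) * besselJ (k%:Z - x + 2) (2 * t)
           - besselJ (j%:Z - x + 2) (2 * t) * besselJ (k%:Z - x + 1) (2 * t))
      / (j%:R - k%:R))%:C).
Proof.
have t_ge0 := ltW t_gt0.
have LE j k : Lkernel r t x j k = (bessel_kernel t x j k)%:C by exact: Lkernel_bes.
split; last by move=> j k jk; rewrite LE bessel_kernel_offdiag.
have Lle := bessel_kernel_le x t_ge0; have C0 := kernel_const_ge0 t x.
exists (limn (series (fredholm_term (bessel_kernel t x)))); split.
  rewrite -(fredholm_det_real C0 Lle); congr fredholm_det.
  by apply/funext => j; apply/funext => k; exact: LE.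
rewrite -cvg_shiftS.
have -> : (fun N => prob_leftmost_ge 0 t (step N.+1) x) =
    (fun N => (\det (1%:M - \matrix_(a < N.+1, b < N.+1) bessel_kernel t x a b))%:E).
  by apply/funext => N; exact: prob_det_kernel.
apply: cvg_EFin; first by apply: nearW.
have [_ h] := det_fredholm_cvg C0 Lle.
by move: h; rewrite -cvg_shiftS.
Qed.
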